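(* Let $I=[0,1]$, let $f_{1,\infty}=\{f_n\}_{n\ge 1}$ be a sequence of surjective continuous maps $f_n:I\to I$, and suppose that $f_{1,\infty}$ converges uniformly to a map $f:I\to I$. If the topological entropy $h(f)$ of $f$ is zero, then every infinite $\omega$-limit set of $f$ is an $\omega$-limit set for $f_{1,\infty}$; that is, for every $z\in I$ such that $\omega_f(z)$ is infinite there is a $y\in I$ with $\omega_{f_{1,\infty}}(y)=\omega_f(z)$.
   Context: A nonautonomous (discrete dynamical) system $(I,f_{1,\infty})$ is given by a sequence $f_{1,\infty}=\{f_n\}_{n\ge1}$ of continuous maps $I\to I$; it is surjective if every $f_n$ is surjective. (The limit map $f$ is also taken to be surjective, which is automatic for a uniform limit of surjective continuous maps of $I$.) The trajectory of $x\in I$ is the sequence $\{x_n\}_{n\ge0}$ with $x_0=x$ and $x_n=(f_n\circ f_{n-1}\circ\cdots\circ f_1)(x)$ for $n\ge 1$. The $\omega$-limit set $\omega_{f_{1,\infty}}(x)$ of $x$ is the set of limit points of its trajectory, i.e. the set of limits of convergent subsequences $\{x_{n_i}\}$ with $n_i\to\infty$. For a single map $f$, $\omega_f(x)$ is the same notion for the constant sequence $f_n=f$. An $\omega$-limit set of $f$ (of $f_{1,\infty}$) is a set of the form $\omega_f(x)$ (respectively $\omega_{f_{1,\infty}}(x)$) for some $x\in I$. *)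

(* Defs.v *)
From HB Require Import structures.
From mathcomp Require Import all_boot all_order all_algebra finmap.
From mathcomp Require Import all_classical all_reals all_analysis.
Set Implicit Arguments.
Unset Strict Implicit.
Unset Printing Implicit Defensive.
Import Order.TTheory GRing.Theory Num.Theory.
Import numFieldNormedType.Exports.
Local Open Scope classical_set_scope.
Local Open Scope ring_scope.

(* Maps of the interval are total functions R -> R of which only the values on
   unit_itv matter. *)
Definition unit_itv (R : realType) : set R := `[0, 1].
Arguments unit_itv : clear implicits.

(* The sequence of maps is f_ 1, f_ 2, ...; the value f_ 0 is never used. *)
Fixpoint trajectory (R : realType) (f_ : nat -> R -> R) (x : R) (n : nat) : R :=
  if n is m.+1 then f_ m.+1 (trajectory f_ x m) else x.

Definition omega_limit (R : realType) (f_ : nat -> R -> R) (x : R) : set R :=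
  [set y | exists s : nat -> nat, {homo s : i j / (i < j)%N} /\
           trajectory f_ x (s i) @[i --> \oo] --> y].

(* Topological entropy, following Bowen: the points of A are pairwise at
   distance > e in the metric max_(i < n) |f^i x - f^i y|. *)
Definition separated (R : realType) (f : R -> R) (n : nat) (e : R)
    (A : {fset R}) : Prop :=
  [set` A] `<=` unit_itv R /\
  forall x y, x \in A -> y \in A -> x != y ->
    exists2 i, (i < n)%N & e < `|iter i f x - iter i f y|.

Definition max_separated (R : realType) (f : R -> R) (n : nat) (e : R) :
    \bar R :=
  ereal_sup [set (#|` A|%:R)%:E | A in separated f n e].

Definition entropy_at (R : realType) (f : R -> R) (e : R) : \bar R :=
  limn_esup (fun n => ((n%:R^-1)%:E * lne (max_separated f n e))%E).

(* entropy_at f is nonincreasing, so the limit exists, possibly +oo. *)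
Definition topological_entropy (R : realType) (f : R -> R) : \bar R :=
  lim (entropy_at f e @[e --> 0^'+]).

(* Main.v *)
Require Import Defs.
From HB Require Import structures.
From mathcomp Require Import all_boot all_order all_algebra finmap.
From mathcomp Require Import all_classical all_reals all_analysis.
From mathcomp Require Import zify ring lra.
Set Implicit Arguments.
Unset Strict Implicit.
Unset Printing Implicit Defensive.
Import Order.TTheory GRing.Theory Num.Theory.
Import numFieldNormedType.Exports.
Local Open Scope classical_set_scope.
Local Open Scope ring_scope.

(** Let F be f preceded by the retraction of the line onto [0, 1], let x n be the
    orbit of z under F, and let omega be its omega-limit set.

    Zero entropy enters only through the absence of folds [no_fold]: no iterate
    g of F has points a < b < c such that g stretches both [a, b] and [b, c]
    over [a, c] in the simplest way, with the images of a and c beyond one end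
    and that of b beyond the other ([entropy0_no_fold]).  Without folds, an orbit
    that does not converge to a periodic orbit eventually alternates between
    the two sides of a fixed point, and stays away from it ([parity_split]).
    Applied to all the iterates F^(2^k), this splits omega into 2^k classes,
    the cluster sets of the orbit along the residues of the time modulo 2^k.
    Each class is cut into two halves, which are classes of level k + 1 and lie
    on both sides of a gap.

    F maps every gap of level k over the next one, in a loop of length 2^k, and
    the gaps of all levels have disjoint interiors, so that they are short when
    k is large.  A trajectory of the perturbed system that stays in these loops
    at higher and higher levels has all its limit points in omega.  For such a
    trajectory to exist, the loops have to survive perturbations.  They do,
    because the ends of the gaps are in omega, which has no periodic points:
    following an end round the loop, one meets a step at which it is mapped
    strictly beyond the end of the next gap, and there all that was lost before
    is recovered ([side_hub], [hub_ex]).  The same steps lead from the gaps of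
    level k to those of level k + 1 ([hub_up]).

    It remains to make the trajectory come near every w in omega.  When gaps of
    high level accumulate at w, the loops do this.  Otherwise w has a companion
    w' in omega in the same class at every level, and there is nothing of omega,
    and almost nothing of the orbit, between w and w' ([visit_class]).  Then w
    is an image F^r v of an end v of a gap of high level in which the orbit
    comes arbitrarily near to v ([visit_dichotomy]).  The segment from an orbit
    point in the gap to v is carried by F^r to w; its later images stay near
    omega until they contain another gap of high level ([excursion]), from
    which the loops are resumed.

    Chaining such loops and excursions gives a sequence of intervals each of
    which is mapped over the next one by the perturbed system
    ([infinite_path]).  By compactness some point runs through them, and as the
    perturbed maps are surjective, it lies on a trajectory that starts at time
    zero. *)

(** * Intervals and cluster points *)

Ltac natlia := repeat match goal with H : ?T |- _ => lazymatch T with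
  | nat => fail | is_true (leq _ _) => fail | @eq nat _ _ => fail | ~ _ => fail
  | is_true (odd _) => fail | _ => clear H end end; lia.

Section Analysis.
Context {R : realType}.
Implicit Types (a b c x y : R) (g : R -> R).

Definition between a b x := (a <= x <= b) || (b <= x <= a).

Lemma between_sym a b x : between a b x = between b a x.
Proof. by rewrite /between orbC. Qed.

Lemma IVT_between g a b y : continuous g -> between (g a) (g b) y ->
  exists2 x, between a b x & g x = y.
Proof.
move=> gc; wlog ab : a b / a <= b.
  move=> H gy; have [ab|/ltW ba] := leP a b; first exact: H.
  by have [|x] := H b a ba; rewrite between_sym //; exists x => //; rewrite between_sym.
move=> gy; have [||x] := @IVT R g a b y ab.
- exact: continuous_subspaceT.
- by rewrite ge_min le_max; case/orP: gy => /andP[-> ->] //; rewrite !orbT.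
by rewrite in_itv /= => xab <-; exists x => //; rewrite /between xab.
Qed.

Lemma iter_continuous g n : continuous g -> continuous (iter n g).
Proof.
by move=> gc; elim: n => [|n IH] x; [exact: cvg_id|apply: continuous_comp; [exact: IH|exact: gc]].
Qed.

Lemma bounded_cluster (s : nat -> R) a b : (forall n, a <= s n <= b) ->
  exists2 l, a <= l <= b &
    forall e, 0 < e -> forall N, exists2 n, (N <= n)%N & `|s n - l| < e.
Proof.
move=> sab.
have [|l [lab clus]] := @segment_compact R a b (s @ \oo) _.
  by exists 0%N => // n _ /=; rewrite in_itv /=.
exists l; first by move: lab; rewrite /= in_itv.
move=> e e0 N.
have [||y [[n Nn <-] yl]] := clus [set s n | n in [set n | (N <= n)%N]] (ball l e).
- by exists N => // n Nn; exists n.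
- by apply/nbhs_ballP; exists e.
by exists n => //; move: yl; rewrite /ball /= distrC.
Qed.

Lemma cont_eps g x e : continuous g -> 0 < e ->
  exists2 d, 0 < d & forall y, `|y - x| < d -> `|g y - g x| < e.
Proof.
move=> gc e0; have := gc x; move/cvgrPdist_lt => /(_ e e0) [d /= d0 Hd].
by exists d => // y yx; rewrite distrC; apply: Hd; rewrite /ball /= distrC.
Qed.

(** Weak inequalities suffice: the two intervals of a fold share the point b, but
    the square of the iterate stretches two disjoint intervals. *)
Definition no_fold g := forall N a b c, (0 < N)%N -> a < b -> b < c ->
  ~ [/\ c <= iter N g a, iter N g b <= a & c <= iter N g c] /\
  ~ [/\ iter N g a <= a, c <= iter N g b & iter N g c <= a].

End Analysis.

(** * Folds and entropy *)

Section Entropy.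
Context {R : realType}.
Implicit Types (f : R -> R).

(** Every word in the two intervals is the itinerary of a point under [iter M f],
    and two points with different words are in different intervals at some
    time. *)
Lemma words_separated f M e (a1 a2 b1 b2 : R) :
  0 <= a1 -> a1 <= a2 -> b1 <= b2 -> b2 <= 1 -> 0 < e -> e < b1 - a2 -> (0 < M)%N ->
  (forall y, a1 <= y <= b2 -> exists2 x, a1 <= x <= a2 & iter M f x = y) ->
  (forall y, a1 <= y <= b2 -> exists2 x, b1 <= x <= b2 & iter M f x = y) ->
  forall m, exists2 A : {fset R}, Defs.separated f (m * M) e A & #|` A| = (2 ^ m)%N.
Proof.
move=> a10 a12 b12 b21 e0 eba M0 covA covB m.
pose I (b : bool) x := if b then a1 <= x <= a2 else b1 <= x <= b2.
have word n : forall w : nat -> bool, exists2 x, a1 <= x <= b2 &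
    forall i, (i < n)%N -> I (w i) (iter (i * M) f x).
  elim: n => [|n IH] w; first by exists a1 => //; lra.
  have [y y12 yw] := IH (w \o succn).
  have [x xI xy] : exists2 x, I (w 0%N) x & iter M f x = y.
    by rewrite /I; case: (w 0%N); [exact: covA|exact: covB].
  exists x; first by move: xI; rewrite /I; case: (w 0%N); lra.
  case=> [|i] //; rewrite ltnS => /yw; rewrite mulSn addnC iterD xy; exact.
have [X HX] : {X : m.-tuple bool -> R & forall w, a1 <= X w <= b2 /\
    forall i, (i < m)%N -> I (nth false w i) (iter (i * M) f (X w))}.
  exists (fun w => projT1 (cid2 (word m (nth false w)))) => w.
  by case: cid2 => x ? ?.
have XE w : a1 <= X w <= b2 by case: (HX w).
have Xi (w : m.-tuple bool) i : (i < m)%N -> I (nth false w i) (iter (i * M) f (X w)) by case: (HX w) => _; apply.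
have sepw (w w' : m.-tuple bool) : w != w' -> exists2 i, (i < m * M)%N & e < `|iter i f (X w) - iter i f (X w')|.
  move=> ww'; have [i im wi] : exists2 i, (i < m)%N & nth false w i != nth false w' i.
    apply: contrapT => H; case/eqP: ww'; apply/val_inj/(@eq_from_nth _ false).
      by rewrite !size_tuple.
    move=> i; rewrite size_tuple => im; apply/eqP/negP => /negP wi; apply: H.
    by exists i.
  exists (i * M)%N; first by rewrite ltn_pmul2r.
  have := Xi w _ im; have := Xi w' _ im; rewrite /I; move: wi.
  by case: (nth false w i); case: (nth false w' i) => // _ H1 H2;
     [rewrite distrC|]; rewrite (lt_le_trans eba)// (le_trans _ (ler_norm _))//; lra.
have Xinj : injective X.
  move=> w w' XX; apply/eqP/negP => /negP /sepw[i _]; rewrite XX subrr normr0; lra.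
exists [fset X w | w in {: m.-tuple bool}]%fset.
  split=> [x /= /imfsetP[w _ ->]|x y /imfsetP[w _ ->] /imfsetP[w' _ ->] xy].
    by rewrite /unit_itv /= in_itv /=; have := XE w; lra.
  by apply: sepw; apply: contra_neq xy => ->.
by rewrite card_imfset //= -cardE card_tuple card_bool.
Qed.

Lemma entropy_at_ge f M e : (0 < M)%N ->
  (forall m, exists2 A : {fset R}, Defs.separated f (m * M) e A & #|` A| = (2 ^ m)%N) ->
  ((ln 2 / M%:R)%:E <= entropy_at f e)%E.
Proof.
move=> M0 sep; rewrite /entropy_at limn_esup_lim.
apply: lime_ge; first exact: is_cvg_esups.
apply: nearW => k; apply: le_ereal_sup_tmp; exists
  (((k.+1 * M)%:R^-1)%:E * lne (max_separated f (k.+1 * M) e))%E.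
  exists (k.+1 * M)%N => //=; apply: leq_trans (leqnSn k) _.
  by rewrite leq_pmulr.
have [A sA cA] := sep k.+1.
have kM0 : (0 : R) < (k.+1 * M)%:R by rewrite ltr0n muln_gt0.
have leA : (((2 ^ k.+1)%:R : R)%:E <= max_separated f (k.+1 * M) e)%E.
  by apply: ereal_sup_ubound; exists A => //; rewrite cA.
have p2 : (0 : R) < (2 ^ k.+1)%:R by rewrite ltr0n expn_gt0.
have E (u v l : R) : u != 0 -> l / v = (u * v)^-1 * (u * l).
  by move=> u0; rewrite invfM -mulrA (mulrCA v^-1) mulKf// mulrC.
have -> : (ln 2 / M%:R : R) = (k.+1 * M)%:R^-1 * ln (2 ^ k.+1)%:R.
  rewrite natrX lnXn ?ltr0n// natrM -(mulr_natl (ln _)).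
  by apply: E; rewrite pnatr_eq0.
rewrite EFinM; apply: lee_wpmul2l; first by rewrite lee_fin invr_ge0 ltW.
rewrite -lne_EFin// lee_lne// in_itv /= ?leey ?andbT; first by rewrite lee_fin ltW.
by apply: le_trans leA; rewrite lee_fin ltW.
Qed.

Lemma entropy_at_anti f e1 e2 : e1 <= e2 -> (entropy_at f e2 <= entropy_at f e1)%E.
Proof.
move=> e12; rewrite /entropy_at !limn_esup_lim.
apply: lee_lim; [exact: is_cvg_esups..|apply: nearW => k].
apply: ge_ereal_sup => _ [n /= kn <-].
apply: le_ereal_sup_tmp; exists (((n%:R^-1)%:E * lne (max_separated f n e1))%E).
  by exists n.
have max0 e : (0 <= max_separated f n e)%E.
  apply: ereal_sup_ubound; exists fset0%fset; last by rewrite cardfs0.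
  by split=> [x|x y]; rewrite /= inE.
rewrite lee_wpmul2l ?lee_fin ?invr_ge0 ?ler0n//.
rewrite lee_lne ?in_itv /= ?max0 ?leey//.
apply: ereal_sup_le => _ [A [AI sA] <-]; exists A => //; split=> // x y xA yA xy.
by have [i ni ei] := sA x y xA yA xy; exists i => //; apply: le_lt_trans ei.
Qed.

(** The limit that defines the entropy is a supremum, by [entropy_at_anti]. *)
Lemma entropy_ge f e c : 0 < e -> (c <= entropy_at f e)%E -> (c <= topological_entropy f)%E.
Proof.
move=> e0 ce.
have ni : {in `]0, +oo[ &, nonincreasing_fun (entropy_at f)}.
  by move=> x y _ _; exact: entropy_at_anti.
have cv := @nonincreasing_at_right_cvge R (entropy_at f) 0 +oo%O isT ni.
rewrite /topological_entropy (cvg_lim _ cv) //.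
apply: le_trans ce _; apply: ereal_sup_ubound.
by exists e => //=; rewrite in_itv /= e0.
Qed.

(** After this retraction, a map of the interval becomes a map of the line with
    the same orbits in the interval, and relative continuity becomes
    continuity. *)
Definition clamp (x : R) := Num.max 0 (Num.min x 1).

Lemma clamp_itv x : unit_itv R (clamp x).
Proof.
by rewrite /unit_itv /= in_itv /= /clamp le_max lexx /= ge_max ler01 /= ge_min lexx orbT.
Qed.

Lemma clamp_id x : unit_itv R x -> clamp x = x.
Proof.
rewrite /unit_itv /= in_itv /= => /andP[x0 x1].
by rewrite /clamp min_l// max_r.
Qed.

Lemma clamp_continuous : continuous clamp.
Proof.
move=> x; apply/cvgrPdist_lt => e e0; exists e => //= y.
have cl z : [\/ clamp z = 0 /\ z <= 0, clamp z = z /\ 0 <= z <= 1 | clamp z = 1 /\ 1 <= z].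
  rewrite /clamp; case: (leP z 1) => z1; last by rewrite max_r //; apply: Or33; split; lra.
  by case: (leP 0 z) => z0; [apply: Or32|apply: Or31]; split; lra.
rewrite /ball /=; apply: le_lt_trans; rewrite ler_norml.
have h1 := ler_norm (x - y).
have h2 : y - x <= `|x - y| by rewrite distrC ler_norm.
by case: (cl x) => -[-> ?]; case: (cl y) => -[-> ?]; lra.
Qed.

Lemma comp_clamp_continuous f :
  {within unit_itv R, continuous f} -> continuous (f \o clamp).
Proof.
move=> fc x; have /subspace_continuousP/(_ _ (clamp_itv x)) fx := fc.
apply: cvg_trans fx; apply: cvg_comp; last exact: cvg_id.
move=> A; rewrite /within /= => nA.
have := clamp_continuous nA; rewrite /= => {}nA; near=> y.
have : (unit_itv R (clamp y) -> A (clamp y)) by near: y; exact: nA.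
by apply; exact: clamp_itv.
Unshelve. all: by end_near.
Qed.

Lemma iter_clamp f n x : set_fun (unit_itv R) (unit_itv R) f -> unit_itv R x ->
  iter n (f \o clamp) x = iter n f x.
Proof.
move=> fI xI; suff: iter n (f \o clamp) x = iter n f x /\ unit_itv R (iter n f x) by case.
elim: n => [|n [IH In]] //=; rewrite IH clamp_id //; split=> //; exact: fI.
Qed.

(** In a fold a < b < c of g, let x in [a, b] and y in [b, c] be preimages of b.
    Then [a, x] and [y, c] are disjoint, and the square of g stretches both
    over [a, c]. *)
Lemma entropy0_no_fold f : set_fun (unit_itv R) (unit_itv R) f ->
  continuous (f \o clamp) -> topological_entropy f = 0%E -> no_fold (f \o clamp).
Proof.
move=> fI Fc h0; set F := f \o clamp.
have F01 n x : (0 < n)%N -> 0 <= iter n F x <= 1.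
  case: n => // n _; have := fI _ (clamp_itv (iter n F x)).
  by rewrite /unit_itv /= in_itv.
(* Disjoint intervals that an iterate stretches over their hull make the entropy
   positive. *)
have pos N a x y c : (0 < N)%N -> 0 <= a -> a <= x -> x < y -> y <= c -> c <= 1 ->
    (forall t, a <= t <= c -> exists2 s, between a x s & iter N F (iter N F s) = t) ->
    (forall t, a <= t <= c -> exists2 s, between y c s & iter N F (iter N F s) = t) -> False.
  move=> N0 a0 ax xy yc c1 covA covB.
  have M0 : (0 < N + N)%N by lia.
  have toI s : a <= s <= c -> unit_itv R s by rewrite /unit_itv /= in_itv /=; lra.
  have e0 : 0 < (y - x) / 2 by lra.
  have /(entropy_ge e0) : ((ln 2 / (N + N)%:R)%:E <= entropy_at f ((y - x) / 2))%E.
    apply: entropy_at_ge => // m; apply: (@words_separated _ _ _ a x y c) => //.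
      lra.
    - move=> t /covA[s]; rewrite /between => sax <-; exists s; first by lra.
      by rewrite -iterD iter_clamp//; apply: toI; lra.
    - move=> t /covB[s]; rewrite /between => sax <-; exists s; first by lra.
      by rewrite -iterD iter_clamp//; apply: toI; lra.
  rewrite h0 lee_fin leNgt divr_gt0// ?ltr0n//.
  by rewrite ln_gt0// ltr1n.
clear h0; move=> N a b c N0 ab bc; set g := iter N F.
have gc : continuous g by exact: iter_continuous.
split=> -[ga gb gc'].
- have a0 : 0 <= a by apply: le_trans gb; case/andP: (F01 N b N0).
  have c1 : c <= 1 by apply: le_trans ga _; case/andP: (F01 N a N0).
  have [x xab gx] : exists2 x, between a b x & g x = b.
    by apply: IVT_between => //; rewrite /between; lra.
  have [y ybc gy] : exists2 y, between b c y & g y = b.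
    by apply: IVT_between => //; rewrite /between; lra.
  have xb : x != b by apply: contra_eqN gx => /eqP ->; lra.
  have yb : y != b by apply: contra_eqN gy => /eqP ->; lra.
  have xlb : x < b by rewrite lt_neqAle xb; move: xab; rewrite /between; lra.
  have bly : b < y by rewrite lt_neqAle eq_sym yb; move: ybc; rewrite /between; lra.
  have mid t : a <= t <= c -> exists2 r, between b c r & g r = t.
    by move=> tac; apply: IVT_between => //; rewrite /between; lra.
  apply: (@pos N a x y c) => //.
  + by move: xab; rewrite /between; lra.
  + lra.
  + by move: ybc; rewrite /between; lra.
  + move=> t /mid[r rbc <-]; have [s sax <-] : exists2 s, between a x s & g s = r.
      by apply: IVT_between => //; move: rbc; rewrite /between gx; lra.
    by exists s.
  + move=> t /mid[r rbc <-]; have [s sax <-] : exists2 s, between y c s & g s = r.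
      by apply: IVT_between => //; move: rbc; rewrite /between gy; lra.
    by exists s.
- have a0 : 0 <= a by apply: le_trans ga; case/andP: (F01 N a N0).
  have c1 : c <= 1 by apply: le_trans gb _; case/andP: (F01 N b N0).
  have [x xab gx] : exists2 x, between a b x & g x = b.
    by apply: IVT_between => //; rewrite /between; lra.
  have [y ybc gy] : exists2 y, between b c y & g y = b.
    by apply: IVT_between => //; rewrite /between; lra.
  have xb : x != b by apply: contra_eqN gx => /eqP ->; lra.
  have yb : y != b by apply: contra_eqN gy => /eqP ->; lra.
  have xlb : x < b by rewrite lt_neqAle xb; move: xab; rewrite /between; lra.
  have bly : b < y by rewrite lt_neqAle eq_sym yb; move: ybc; rewrite /between; lra.
  have mid t : a <= t <= c -> exists2 r, between a b r & g r = t.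
    by move=> tac; apply: IVT_between => //; rewrite /between; lra.
  apply: (@pos N a x y c) => //.
  + by move: xab; rewrite /between; lra.
  + lra.
  + by move: ybc; rewrite /between; lra.
  + move=> t /mid[r rbc <-]; have [s sax <-] : exists2 s, between a x s & g s = r.
      by apply: IVT_between => //; move: rbc; rewrite /between gx; lra.
    by exists s.
  + move=> t /mid[r rbc <-]; have [s sax <-] : exists2 s, between y c s & g s = r.
      by apply: IVT_between => //; move: rbc; rewrite /between gy; lra.
    by exists s.
Qed.

End Entropy.

(** * Orbits of maps without folds *)

Section Orbits.
Context {R : realType}.
Implicit Types (g : R -> R) (a b c p x y : R).

Definition reflect_map g x := - g (- x).

Lemma iter_reflect g n x : iter n (reflect_map g) x = - iter n g (- x).
Proof. by elim: n => [|n IH] /=; rewrite ?opprK // IH /reflect_map opprK. Qed.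

Lemma reflect_continuous g : continuous g -> continuous (reflect_map g).
Proof.
move=> gc x; apply: continuousN; apply: (@continuous_comp _ _ _ -%R g); last exact: gc.
exact: opp_continuous.
Qed.

Lemma no_fold_reflect g : no_fold g -> no_fold (reflect_map g).
Proof.
move=> nf N a b c N0 ab bc; rewrite !iter_reflect.
have [||H1 H2] := nf N (- c) (- b) (- a) N0; [lra..|].
by split=> -[h1 h2 h3]; [apply: H2|apply: H1]; split; lra.
Qed.

Lemma no_fold_iter g M : (0 < M)%N -> no_fold g -> no_fold (iter M g).
Proof.
move=> M0 nf N a b c N0 ab bc; rewrite -!iterM.
by apply: nf => //; rewrite muln_gt0 N0.
Qed.

Lemma last_fixed_point g a b : continuous g -> b < a -> a < g a -> g b <= b ->
  exists q, [/\ b <= q, q < a, g q = q & forall x, q < x <= a -> x < g x].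
Proof.
move=> gc ba ga gb.
pose S := [set x | b <= x <= a /\ g x <= x].
have Sb : S b by split=> //; rewrite lexx ltW.
have supS : has_sup S by split; [exists b|exists a => x [/andP[]]].
pose q := sup S.
have bq : b <= q by apply: sup_ubound => //; case: supS.
have qa : q <= a by apply: sup_le_ub => //; [exists b|move=> x [/andP[]]].
have above x : q < x <= a -> x < g x.
  move=> /andP[qx xa]; rewrite ltNge; apply/negP => gx.
  have : x <= q by apply: sup_ubound; [case: supS|split=> //; lra].
  lra.
have hc e : 0 < e -> exists2 d, 0 < d & forall x, `|x - q| < d -> `|(g x - x) - (g q - q)| < e.
  move=> e0; apply: (@cont_eps _ (fun x => g x - x)) => // x.
  by apply: cvgB; [exact: gc|exact: cvg_id].
have gq : g q <= q.
  rewrite leNgt; apply/negP => gq.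
  have [d d0 Hd] := hc (g q - q) ltac:(lra).
  have [x [xab gx] xq] := sup_adherent d0 supS.
  have xq' : x <= q by apply: sup_ubound => //; case: supS.
  have /Hd : `|x - q| < d by rewrite ltr_norml; rewrite -/q in xq; lra.
  by rewrite ltr_norml; lra.
have qa' : q < a by rewrite lt_neqAle qa andbT; apply: contraTneq gq => ->; rewrite -ltNge.
exists q; split=> //; apply/eqP; rewrite eq_le gq /= leNgt; apply/negP => gq'.
have [d d0 Hd] := hc (q - g q) ltac:(lra).
pose x := q + Num.min (d / 2) (a - q).
have mp : 0 < Num.min (d / 2) (a - q) by rewrite lt_min; apply/andP; split; lra.
have m1 : Num.min (d / 2) (a - q) <= d / 2 by rewrite ge_min lexx.
have m2 : Num.min (d / 2) (a - q) <= a - q by rewrite ge_min lexx orbT.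
have /above gx : q < x <= a by rewrite /x; lra.
have /Hd : `|x - q| < d by rewrite ltr_norml /x; lra.
by rewrite ltr_norml; lra.
Qed.

(** The point p repels to the right, so that an orbit from (p, a] first passes a
    before it returns to p or below.  Hence, for some n, a point e of (p, a] is
    mapped to p by g^n, while some u between p and e is mapped beyond e: this is
    a fold on p < u < e. *)
Lemma stays_right_of_fixed g p a : continuous g -> no_fold g -> g p = p -> p < a ->
  (forall x, p < x <= a -> x < g x) -> forall n, p < iter n g a.
Proof.
move=> gc nf gp pa up n; rewrite ltNge; apply/negP => low.
have ex : exists n, iter n g a <= p by exists n.
case: (ex_minnP ex) => {n low ex} n low minn.
case: n low minn => [|m] low minn; first by move: low => /=; lra.
have iterp k : iter k g p = p by elim: k => //= k ->.
pose c := iter m g a.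
have pc : p < c by rewrite ltNge; apply/negP => /minn; rewrite ltnn.
have gcp : g c <= p by [].
have ac : a < c by rewrite ltNge; apply/negP => ca; have := up c; rewrite pc ca => /(_ isT); lra.
have ga : a < g a by apply: up; lra.
have m0 : (0 < m)%N by case: m @c ac {low minn pc gcp} => //=; rewrite ltxx.
have [d dac gd] : exists2 d, between a c d & g d = p.
  by apply: IVT_between => //; rewrite /between; lra.
have ad : a < d.
  by rewrite lt_neqAle; apply/andP; split; [apply: contra_eqN gd => /eqP <-; lra|
    move: dac; rewrite /between; lra].
have gmc : continuous (iter m g) by exact: iter_continuous.
have [e ep gme] : exists2 e, between p a e & iter m g e = d.
  by apply: IVT_between => //; rewrite iterp -/c; move: dac; rewrite /between; lra.
have pe : p < e.
  rewrite lt_neqAle; apply/andP; split; last by move: ep; rewrite /between; lra.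
  by apply: contra_eqN gme => /eqP <-; rewrite iterp; lra.
have [u ue gmu] : exists2 u, between p e u & iter m g u = a.
  by apply: IVT_between => //; rewrite iterp gme /between; lra.
have pu : p < u.
  rewrite lt_neqAle; apply/andP; split; last by move: ue; rewrite /between; lra.
  by apply: contra_eqN gmu => /eqP <-; rewrite iterp; lra.
have ltue : u < e.
  rewrite lt_neqAle; apply/andP; split; last by move: ue; rewrite /between; lra.
  by apply: contra_eqN gmu => /eqP ->; rewrite gme; lra.
have [_] := nf m.+1 p u e isT pu ltue; apply.
rewrite !iterS iterp gme gmu gd gp; split=> //.
by apply: ltW; apply: le_lt_trans ga; move: ep; rewrite /between; lra.
Qed.

(** The last fixed point between b and a repels to the right. *)
Lemma up_never_down g a b : continuous g -> no_fold g -> a < g a -> b < a -> g b <= b ->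
  forall n, b < iter n g a.
Proof.
move=> gc nf ga ba gb n.
have [q [bq qa gq up]] := last_fixed_point gc ba ga gb.
exact: le_lt_trans bq (stays_right_of_fixed gc nf gq qa up n).
Qed.

Lemma down_never_up g a b : continuous g -> no_fold g -> g a < a -> a < b -> b <= g b ->
  forall n, iter n g a < b.
Proof.
move=> gc nf ga ab gb n.
have := @up_never_down _ (- a) (- b) (reflect_continuous gc) (no_fold_reflect nf) _ _ _ n.
rewrite iter_reflect !opprK /reflect_map !opprK => H.
suff : - b < - iter n g a by lra.
by apply: H; lra.
Qed.

(** If the upward move started above the downward move, then the later of the two
    would contradict [up_never_down] or [down_never_up]. *)
Lemma up_lt_down g y i j : continuous g -> no_fold g ->
  iter i g y < iter i.+1 g y -> iter j.+1 g y < iter j g y -> iter i g y < iter j g y.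
Proof.
move=> gc nf up dn; rewrite ltNge le_eqVlt; apply/negP => /orP[/eqP e|lt].
  by move: up dn; rewrite /= e; lra.
have [ij|/ltnW ji] := leqP i j.
  have := @up_never_down g (iter i g y) (iter j g y) gc nf up lt (ltW dn) (j - i)%N.
  by rewrite -iterD subnK // ltxx.
have := @down_never_up g (iter j g y) (iter i g y) gc nf dn lt (ltW up) (i - j)%N.
by rewrite -iterD subnK // ltxx.
Qed.

(** To return below its i-th point, the orbit has to jump back from a point where
    it moves down.  There is a fixed point p between the end of the first upward
    move and that point, and the iterate of g over the time of the return makes a
    fold of p and of the ends of the first move. *)
Lemma up_up_later g y i m : continuous g -> no_fold g ->
  (forall n, iter n g y != iter n.+1 g y) ->
  iter i g y < iter i.+1 g y -> iter i.+1 g y < iter i.+2 g y -> (i < m)%N ->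
  iter i g y < iter m g y.
Proof.
move=> gc nf nofix up1 up2; elim: m => // m IH; rewrite ltnS leq_eqVlt.
case/orP=> [/eqP <- //|im]; have {}IH := IH im.
rewrite ltNge; apply/negP => low.
have [up|dn] := ltP (iter m g y) (iter m.+1 g y); first lra.
have {}dn : iter m.+1 g y < iter m g y by rewrite lt_neqAle eq_sym nofix.
have lt := up_lt_down gc nf up2 dn.
have [p pb gp] : exists2 p, between (iter i.+1 g y) (iter m g y) p & (fun x => g x - x) p = 0.
  apply: IVT_between; last by rewrite /between; move: up2 dn => /=; lra.
  by move=> x; apply: cvgB; [exact: gc|exact: cvg_id].
have {}gp : g p = p by move: gp => /=; lra.
have itp k : iter k g p = p by elim: k => //= k ->.
have pm : p <= iter m g y by move: pb; rewrite /between; lra.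
have ip : iter i.+1 g y < p.
  rewrite lt_neqAle; apply/andP; split; last by move: pb; rewrite /between; lra.
  by apply: contraTneq up2 => /=; rewrite -/(iter i.+1 g y) => ->; rewrite gp ltxx.
have mi0 : (0 < m - i)%N by rewrite subn_gt0.
have [H _] := nf _ _ _ p mi0 up1 ip.
by apply: H; split; rewrite -?iterD ?addnS ?subnK ?itp// ltnW.
Qed.

Lemma down_down_later g y i m : continuous g -> no_fold g ->
  (forall n, iter n g y != iter n.+1 g y) ->
  iter i.+1 g y < iter i g y -> iter i.+2 g y < iter i.+1 g y -> (i < m)%N ->
  iter m g y < iter i g y.
Proof.
move=> gc nf nofix dn1 dn2 im.
have := @up_up_later _ (- y) i m (reflect_continuous gc) (no_fold_reflect nf) _ _ _ im.
rewrite !iter_reflect !opprK !ltrN2; apply => // n.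
by rewrite !iter_reflect !opprK eqr_opp.
Qed.

(** By [up_up_later] and its mirror image, a periodic orbit never moves twice in
    the same direction; moves that alternate have an even period. *)
Lemma odd_period_fixed g y N : continuous g -> no_fold g -> odd N ->
  iter N g y = y -> g y = y.
Proof.
move=> gc nf oN yN; apply/eqP/negP => /negP gy.
have per i : iter (i + N) g y = iter i g y by rewrite iterD yN.
have nofix n : iter n g y != iter n.+1 g y.
  apply: contra gy => /eqP E.
  have fx k : iter (n + k) g y = iter n g y.
    by elim: k => [|k IH]; rewrite ?addn0 // addnS /= IH [RHS]E.
  have perk k : iter (k * N) g y = y.
    by elim: k => // k IH; rewrite mulSn addnC per.
  have N0 : (0 < N)%N by case: (N) oN.
  have yn : y = iter n g y.
    have e : (n + (n * N - n) = n * N)%N by rewrite subnKC // leq_pmulr.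
    by rewrite -(fx (n * N - n)%N) e perk.
  by apply/eqP; have := E; rewrite /= -yn => <-.
pose s i := iter i g y < iter i.+1 g y.
have sN i : ~~ s i = (iter i.+1 g y < iter i g y).
  by rewrite -leNgt le_eqVlt eq_sym (negbTE (nofix i)).
have alt i : s i.+1 = ~~ s i.
  case si : (s i); case si1 : (s i.+1) => //.
    have N0 : (i < i + N)%N by case: (N) oN => // k _; rewrite addnS ltnS leq_addr.
    by have := up_up_later gc nf nofix si si1 N0; rewrite per ltxx.
  move/negbT: si; move/negbT: si1; rewrite !sN => d2 d1.
  have N0 : (i < i + N)%N by case: (N) oN => // k _; rewrite addnS ltnS leq_addr.
  by have := down_down_later gc nf nofix d1 d2 N0; rewrite per ltxx.
have altn n : s n = s 0%N (+) odd n.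
  by elim: n => [|n IH]; rewrite ?addbF //= alt IH -addbN.
have := altn N; rewrite oN /s -(add0n N) per -add1n addnA addn0 per /=.
by case: (_ < _).
Qed.

End Orbits.

(** * Aperiodic orbits alternate *)

Section Alternation.
Context {R : realType}.
Implicit Types (g : R -> R) (a b c p x y : R).

Definition not_asymptotically_periodic g y := forall T i l, (0 < T)%N ->
  ~ (forall e, 0 < e -> exists N, forall n, (N <= n)%N -> `|iter (i + T * n) g y - l| < e).

Lemma nap_not_fixed g y n : not_asymptotically_periodic g y ->
  iter n g y != iter n.+1 g y.
Proof.
move=> na; apply/eqP => E; apply: (na 1%N n (iter n g y) isT) => e e0.
have fx k : iter (n + k) g y = iter n g y.
  by elim: k => [|k IH]; rewrite ?addn0 // addnS /= IH [RHS]E.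
by exists 0%N => k _; rewrite mul1n fx subrr normr0.
Qed.

Lemma nap_shift g y i : not_asymptotically_periodic g y ->
  not_asymptotically_periodic g (iter i g y).
Proof.
move=> na T j l T0 H; apply: (na T (j + i)%N l T0) => e /H[N HN].
by exists N => n /HN; rewrite -iterD addnAC.
Qed.

Lemma nap_iter g y M : (0 < M)%N -> not_asymptotically_periodic g y ->
  not_asymptotically_periodic (iter M g) y.
Proof.
move=> M0 na T i l T0 H; apply: (na (T * M)%N (i * M)%N l); first by rewrite muln_gt0 T0.
move=> e /H[N HN]; exists N => n /HN.
by rewrite -iterM mulnDl mulnAC.
Qed.

Lemma nap_reflect g y : not_asymptotically_periodic g y ->
  not_asymptotically_periodic (reflect_map g) (- y).
Proof.
move=> na T i l T0 H; apply: (na T i (- l) T0) => e /H[N HN]; exists N => n /HN.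
by rewrite iter_reflect opprK -opprD normrN opprK.
Qed.

Definition infinitely_often (P : nat -> Prop) := forall N, exists2 n, (N <= n)%N & P n.

(** Let u i be the orbit.  Two double upward moves, at times i < j of the same
    parity, enclose a point t with t <= g t <= u j: if u i.+1 <= u j take
    t = u i, and otherwise the iterate of g of odd order j - i - 1 has a fixed
    point between u i and u i.+1, which g fixes by [odd_period_fixed].  So the
    double moves start at points that increase to a fixed point c, and no upward
    move starts at or above c, since it would never come back below c. *)
Lemma up_up_often_limit g y : continuous g -> no_fold g ->
  not_asymptotically_periodic g y -> (exists B, forall n, iter n g y <= B) ->
  infinitely_often (fun i => iter i g y < iter i.+1 g y < iter i.+2 g y) ->
  exists c, [/\ g c = c,
    forall n, iter n g y < iter n.+1 g y -> iter n g y < c &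
    forall e, 0 < e -> exists N, forall n, (N <= n)%N -> c - e < iter n g y].
Proof.
move=> gc nf na [B HB] io; pose u n := iter n g y.
have nofix n : u n != u n.+1 by exact: nap_not_fixed.
have [b iob] : exists b : bool, infinitely_often (fun i => u i < u i.+1 < u i.+2 /\ odd i = b).
  apply: contrapT => H.
  have [N1 H1] : exists N, forall n, (N <= n)%N -> u n < u n.+1 < u n.+2 -> ~~ odd n.
    apply: contrapT => H1; apply: H; exists true => N; apply: contrapT => H2.
    apply: H1; exists N => n Nn un; apply/negP => on; apply: H2.
    by exists n.
  have [N2 H2] : exists N, forall n, (N <= n)%N -> u n < u n.+1 < u n.+2 -> odd n.
    apply: contrapT => H2; apply: H; exists false => N; apply: contrapT => H3.
    apply: H2; exists N => n Nn un; apply/negPn/negP => on; apply: H3.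
    by exists n => //; split=> //; apply/negbTE.
  have [n Nn un] := io (N1 + N2)%N.
  have := H1 n (leq_trans (leq_addr _ _) Nn) un.
  by rewrite (H2 n (leq_trans (leq_addl _ _) Nn) un).
pose S := [set u i | i in [set i | u i < u i.+1 < u i.+2 /\ odd i = b]].
have [i0 _ Si0] := iob 0%N.
have supS : has_sup S by split; [exists (u i0), i0|exists B => _ [i _ <-]; exact: HB].
pose c := sup S.
have later i m : u i < u i.+1 < u i.+2 -> (i < m)%N -> u i < u m.
  by case/andP => h1 h2 im; apply: (up_up_later gc nf nofix).
have Sltc i : u i < u i.+1 < u i.+2 /\ odd i = b -> u i < c.
  move=> Hi; have [j ij [jup oj]] := iob i.+1.
  apply: lt_le_trans (later i j Hi.1 ij) _.
  by apply: sup_ubound; [case: supS|exists j].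
have jump i j : u i < u i.+1 < u i.+2 /\ odd i = b ->
    u j < u j.+1 < u j.+2 /\ odd j = b -> (i < j)%N ->
    exists2 t, u i <= t <= u j & t <= g t <= u j.
  move=> [ui oi] [uj oj] ij; have /andP[ui1 ui2] := ui.
  have [le|lt] := leP (u i.+1) (u j).
    exists (u i); first by rewrite lexx ltW // later.
    by rewrite -[g _]/(u i.+1) (ltW ui1).
  pose N := (j - i).-1.
  have i1 : (i.+1 < j)%N.
    by rewrite ltn_neqAle ij andbT; apply: contraTneq lt => <-; rewrite ltxx.
  have oN : odd N by rewrite /N -subnS oddB //= oi oj; case: (b).
  have [t tb gt] : exists2 t, between (u i) (u i.+1) t & (fun x => iter N g x - x) t = 0.
    apply: IVT_between.
      by move=> x; apply: cvgB; [exact: iter_continuous|exact: cvg_id].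
    rewrite /u -!iterD.
    have -> : (N + i.+1 = j)%N by rewrite /N; natlia.
    have Ni : (i < N + i)%N by rewrite /N; natlia.
    have := later _ _ ui Ni; rewrite /between /u => ?.
    by apply/orP; right; apply/andP; split; rewrite /u in lt; lra.
  have {}gt : iter N g t = t by move: gt => /=; lra.
  have fixt := odd_period_fixed gc nf oN gt.
  have it : u i <= t by move: tb; rewrite /between; lra.
  have ti : t < u i.+1.
    rewrite lt_neqAle; apply/andP; split; last by move: tb; rewrite /between; lra.
    by apply/eqP => te; move: ui2; rewrite -[u i.+2]/(g (u i.+1)) -te fixt ltxx.
  have tj : t < u j.
    have := @up_never_down _ g (u i.+1) t gc nf ui2 ti _ (j - i.+1)%N.
    by rewrite fixt lexx -iterD subnK //; apply.
  by exists t; rewrite ?fixt; lra.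
have gcc : g c = c.
  apply/eqP; rewrite -subr_eq0 -normr_eq0 eq_le normr_ge0 andbT.
  apply/ler_addgt0Pl => e e0; rewrite addr0.
  have [d d0 Hd] := @cont_eps _ g c (e / 2) gc ltac:(lra).
  have dd : 0 < Num.min d (e / 2) by rewrite lt_min d0; lra.
  have [_ [i Hi <-] ci] := sup_adherent dd supS; rewrite -/c in ci.
  have m1 : Num.min d (e / 2) <= d by rewrite ge_min lexx.
  have m2 : Num.min d (e / 2) <= e / 2 by rewrite ge_min lexx orbT.
  have [j ij Hj] := iob i.+1.
  have [t tij gt] := jump i j Hi Hj ij.
  have jc := Sltc j Hj.
  have /Hd : `|t - c| < d by rewrite ltr_norml; lra.
  by rewrite ltr_norml ler_norml; lra.
exists c; split=> // [n un|e e0].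
  rewrite ltNge le_eqVlt; apply/negP => /orP[/eqP cn|cn].
    by move: (nofix n); rewrite -[u n.+1]/(g (u n)) /u -cn gcc eqxx.
  have [j nj Hj] := iob n.
  have := @up_never_down _ g (u n) c gc nf un cn _ (j - n)%N.
  rewrite gcc lexx -iterD subnK // => /(_ isT); have := Sltc j Hj; rewrite /u; lra.
have [_ [i Hi <-] ci] := sup_adherent e0 supS.
exists i.+1 => n ni; apply: lt_trans ci _; exact: later Hi.1 ni.
Qed.

Lemma down_down_often_limit g y : continuous g -> no_fold g ->
  not_asymptotically_periodic g y -> (exists B, forall n, B <= iter n g y) ->
  infinitely_often (fun i => iter i.+2 g y < iter i.+1 g y < iter i g y) ->
  exists c, [/\ g c = c,
    forall n, iter n.+1 g y < iter n g y -> c < iter n g y &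
    forall e, 0 < e -> exists N, forall n, (N <= n)%N -> iter n g y < c + e].
Proof.
move=> gc nf na [B HB] io.
have [|N|c [gcc up near]] := @up_up_often_limit _ _ (reflect_continuous gc)
    (no_fold_reflect nf) (nap_reflect na).
- by exists (- B) => n; rewrite iter_reflect opprK lerN2.
- have [n Nn un] := io N; exists n => //.
  by rewrite !iter_reflect !opprK !ltrN2 andbC.
exists (- c); split.
- by rewrite -[in RHS]gcc /reflect_map opprK.
- move=> n un; have := up n; rewrite !iter_reflect !opprK !ltrN2 => /(_ un); lra.
- move=> e /near[N HN]; exists N => n /HN; rewrite iter_reflect opprK; lra.
Qed.

(** Let c be the limit given by [up_up_often_limit].  If double downward moves
    recur as well, their limit c' is at least c; when c < c', an orbit near c
    keeps moving up, and when c = c' it converges.  If they do not recur, then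
    downward moves follow upward ones, which start near the fixed point c, and
    the orbit converges to c again. *)
Lemma nap_not_up_up_often g y : continuous g -> no_fold g ->
  not_asymptotically_periodic g y -> (exists A B, forall n, A <= iter n g y <= B) ->
  ~ infinitely_often (fun i => iter i g y < iter i.+1 g y < iter i.+2 g y).
Proof.
move=> gc nf na [A [B AB]] io; pose u n := iter n g y.
have nofix n : u n != u n.+1 by exact: nap_not_fixed.
have dnE n : ~~ (u n < u n.+1) -> u n.+1 < u n.
  by rewrite -leNgt le_eqVlt eq_sym (negbTE (nofix n)).
have [|c [gcc up near]] := up_up_often_limit gc nf na _ io.
  by exists B => n; case/andP: (AB n).
have [dd|ndd] := pselect (infinitely_often (fun i => u i.+2 < u i.+1 < u i)).
  have [|c' [gcc' dn near']] := down_down_often_limit gc nf na _ dd.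
    by exists A => n; case/andP: (AB n).
  have cc' : c <= c'.
    rewrite leNgt; apply/negP => lt.
    have [N1 H1] := near ((c - c') / 2) ltac:(lra).
    have [N2 H2] := near' ((c - c') / 2) ltac:(lra).
    have := H1 (N1 + N2)%N (leq_addr _ _); have := H2 (N1 + N2)%N (leq_addl _ _); lra.
  have [eq|lt] := eqVneq c c'.
    apply: (na 1%N 0%N c isT) => e e0.
    have [N1 H1] := near e e0; have [N2 H2] := near' e e0.
    exists (N1 + N2)%N => n nN; rewrite add0n mul1n ltr_norml.
    by have := H1 n ltac:(natlia); have := H2 n ltac:(natlia); rewrite eq; lra.
  have {lt} ltc : c < c' by rewrite lt_neqAle lt.
  have [d d0 Hd] := @cont_eps _ g c (c' - c) gc ltac:(lra).
  have [N HN] := near d d0.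
  have [n Nn /andP[un _]] := io N.
  have all_up m : (n <= m)%N -> u m < u m.+1.
    elim: m => [|m IH]; first by rewrite leqn0 => /eqP e; rewrite e in un.
    rewrite leq_eqVlt => /orP[/eqP <- //|nm]; have um := IH nm.
    apply: contraT => /dnE h; have lt := dn m.+1 h.
    have /Hd : `|u m - c| < d.
      have := up m um; have := HN m (leq_trans Nn nm); rewrite /u ltr_norml; lra.
    by rewrite gcc -[g _]/(u m.+1) ltr_norml; rewrite /u in lt *; lra.
  have [m nm /andP[_ um]] := dd n; have := all_up m nm; lra.
have [N0 H0] : exists N, forall n, (N <= n)%N -> ~ (u n.+2 < u n.+1 < u n).
  apply: contrapT => H; apply: ndd => N; apply: contrapT => H1; apply: H.
  by exists N => n Nn un; apply: H1; exists n.
apply: (na 1%N 0%N c isT) => e e0.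
have [d d0 Hd] := @cont_eps _ g c e gc e0.
have [N1 H1] := near e e0; have [N2 H2] := near d d0.
exists (N0 + N1 + N2).+1 => -[//|n] nN; rewrite add0n mul1n.
have [un1|/negP/dnE dn1] := pselect (u n.+1 < u n.+2).
  by have := H1 n.+1 ltac:(natlia); have := up _ un1; rewrite ltr_norml /u; lra.
have un : u n < u n.+1.
  by apply: contraT => /dnE un; case: (H0 n ltac:(natlia)); rewrite dn1.
rewrite -gcc -[X in `|X - _|]/(g (u n)); apply: Hd.
by have := H2 n ltac:(natlia); have := up _ un; rewrite ltr_norml /u; lra.
Qed.

Lemma nap_alternates g y : continuous g -> no_fold g ->
  not_asymptotically_periodic g y -> (exists A B, forall n, A <= iter n g y <= B) ->
  exists N, forall n, (N <= n)%N ->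
    (iter n.+1 g y < iter n.+2 g y) = ~~ (iter n g y < iter n.+1 g y).
Proof.
move=> gc nf na [A [B AB]]; pose u n := iter n g y.
have nofix n : u n != u n.+1 by exact: nap_not_fixed.
have dnE n : ~~ (u n < u n.+1) = (u n.+1 < u n).
  by rewrite -leNgt le_eqVlt eq_sym (negbTE (nofix n)).
have nuu : ~ infinitely_often (fun i => u i < u i.+1 < u i.+2).
  by apply: nap_not_up_up_often => //; exists A, B.
have ndd : ~ infinitely_often (fun i => u i.+2 < u i.+1 < u i).
  move=> io; apply: (nap_not_up_up_often (reflect_continuous gc) (no_fold_reflect nf)
    (nap_reflect na)).
    by exists (- B), (- A) => n; rewrite iter_reflect opprK !lerN2 andbC.
  move=> N; have [n Nn un] := io N; exists n => //.
  by rewrite !iter_reflect !opprK !ltrN2 andbC.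
have ev P : ~ infinitely_often P -> exists N, forall n, (N <= n)%N -> ~ P n.
  move=> nP; apply: contrapT => H; apply: nP => N; apply: contrapT => H1; apply: H.
  by exists N => n Nn un; apply: H1; exists n.
have [N1 H1] := ev _ nuu; have [N2 H2] := ev _ ndd.
exists (N1 + N2)%N => n nN; have := H1 n ltac:(natlia); have := H2 n ltac:(natlia).
rewrite -[iter n.+1 g y]/(u n.+1) -[iter n g y]/(u n) -[iter n.+2 g y]/(u n.+2).
case un: (u n < u n.+1); case un1: (u n.+1 < u n.+2) => //= h1 h2.
case: h1; apply/andP; split.
  by have := dnE n.+1; rewrite -[u n.+1 < u n.+2]/(g (u n) < g (g (u n))) un1 => /esym.
by rewrite -[_ < _]/(u n.+1 < u n) -dnE un.
Qed.

(** The orbit alternates.  If it moved down from a point very near to p, it would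
    still be near p at the next step, which is an upward move; but upward moves
    start below all the points at which the orbit moves down. *)
Lemma nap_bounded_away g p y : continuous g -> no_fold g ->
  not_asymptotically_periodic g y -> (exists A B, forall n, A <= iter n g y <= B) ->
  g p = p -> (forall n, iter n g y < p) ->
  exists e N, 0 < e /\ forall n, (N <= n)%N -> iter n g y <= p - e.
Proof.
move=> gc nf na bnd gp below; pose u n := iter n g y.
have nofix n : u n != u n.+1 by exact: nap_not_fixed.
have dnE n : ~~ (u n < u n.+1) = (u n.+1 < u n).
  by rewrite -leNgt le_eqVlt eq_sym (negbTE (nofix n)).
have [N alt] := nap_alternates gc nf na bnd.
have [n0 Nn0 dn0] : exists2 n, (N <= n)%N & u n.+1 < u n.
  have [|un] := boolP (u N.+1 < u N); first by exists N.
  rewrite -dnE in un; exists N.+1 => //; rewrite -dnE /u alt //; exact: un.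
apply: contrapT => H.
have [d d0 Hd] := @cont_eps _ g p (p - u n0) gc ltac:(have := below n0; rewrite /u; lra).
pose m := Num.min (p - u n0) d.
have m0 : 0 < m by rewrite lt_min d0; have := below n0; rewrite /u; lra.
have m1 : m <= p - u n0 by rewrite ge_min lexx.
have m2 : m <= d by rewrite ge_min lexx orbT.
have [n Nn un] : exists2 n, (N <= n)%N & p - m < u n.
  apply: contrapT => H1; apply: H; exists m, N; split=> // n Nn.
  by rewrite leNgt; apply/negP => lt; apply: H1; exists n.
have dn : u n.+1 < u n.
  rewrite -dnE; apply/negP => up.
  by have := up_lt_down gc nf up dn0; rewrite -!/(u _); lra.
have up1 : u n.+1 < u n.+2 by rewrite /u alt // dnE.
have := up_lt_down gc nf up1 dn0; rewrite -!/(u _).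
have /Hd : `|u n - p| < d by have := below n; rewrite -/(u n) ltr_norml; lra.
by rewrite gp -[g _]/(u n.+1) ltr_norml; lra.
Qed.

(** An alternating orbit jumps from one side of a fixed point to the other.  Along
    each parity it is an orbit of the square of g, to which [nap_bounded_away]
    applies. *)
Lemma parity_split g y : continuous g -> no_fold g ->
  not_asymptotically_periodic g y -> (exists A B, forall n, A <= iter n g y <= B) ->
  exists N (b : bool) p e, 0 < e /\ forall n, (N <= n)%N ->
    if odd n == b then iter n g y <= p - e else p + e <= iter n g y.
Proof.
move=> gc nf na [A [B AB]]; pose u n := iter n g y.
have nofix n : u n != u n.+1 by exact: nap_not_fixed.
have dnE n : ~~ (u n < u n.+1) = (u n.+1 < u n).
  by rewrite -leNgt le_eqVlt eq_sym (negbTE (nofix n)).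
have [|N alt] := nap_alternates gc nf na; first by exists A, B.
pose b := odd N (+) ~~ (u N < u N.+1).
have upE n : (N <= n)%N -> (u n < u n.+1) = (odd n == b).
  elim: n => [|n IH]; first by rewrite leqn0 /b => /eqP ->; case: (_ < _).
  rewrite leq_eqVlt => /orP[/eqP <-|nN].
    by rewrite /b; case: (odd N); case: (_ < _).
  by rewrite /u alt // -!/(u _) IH //=; case: (odd n); case: (b).
have [n1 Nn1 un1] : exists2 n, (N <= n)%N & u n < u n.+1.
  have [|un] := boolP (u N < u N.+1); first by exists N.
  by exists N.+1 => //; rewrite /u alt.
have [n2 Nn2 un2] : exists2 n, (N <= n)%N & u n.+1 < u n.
  have [|un] := boolP (u N.+1 < u N); first by exists N.
  rewrite -dnE in un; exists N.+1 => //; rewrite -dnE /u alt //; exact: un.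
pose SU := [set u n | n in [set n | u n < u n.+1]].
pose q := sup SU.
have supU : has_sup SU by split; [exists (u n1), n1|exists B => _ [n _ <-]; case/andP: (AB n)].
have Uq n : u n < u n.+1 -> u n <= q by move=> un; apply: sup_ubound; [case: supU|exists n].
have qD n : u n.+1 < u n -> q <= u n.
  move=> un; apply: sup_le_ub; first by case: supU.
  by move=> _ [k uk <-]; apply/ltW/(up_lt_down gc nf).
have gq : q <= g q.
  rewrite leNgt; apply/negP => gq.
  have [d d0 Hd] := @cont_eps _ (fun x => g x - x) q (q - g q)
    (fun x => cvgB (gc x) cvg_id) ltac:(lra).
  have [_ [n un <-] qn] := sup_adherent d0 supU.
  have /Hd : `|u n - q| < d by have := Uq n un; rewrite ltr_norml; rewrite -/q in qn; lra.
  by rewrite -[g (u n)]/(u n.+1) ltr_norml; move: un => /=; lra.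
pose SD := [set u n | n in [set n | u n.+1 < u n]].
pose r := inf SD.
have infD : has_inf SD by split; [exists (u n2), n2|exists A => _ [n _ <-]; case/andP: (AB n)].
have Dr n : u n.+1 < u n -> r <= u n by move=> un; apply: inf_lbound; [case: infD|exists n].
have qr : q <= r by apply: lb_le_inf; [case: infD|move=> _ [n un <-]; exact: qD].
have gr : g r <= r.
  rewrite leNgt; apply/negP => gr.
  have [d d0 Hd] := @cont_eps _ (fun x => g x - x) r (g r - r)
    (fun x => cvgB (gc x) cvg_id) ltac:(lra).
  have [_ [n un <-] rn] := inf_adherent d0 infD.
  have /Hd : `|u n - r| < d by have := Dr n un; rewrite ltr_norml; rewrite -/r in rn; lra.
  by rewrite -[g (u n)]/(u n.+1) ltr_norml; move: un => /=; lra.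
have [p pb gp] : exists2 p, between q r p & (fun x => g x - x) p = 0.
  apply: IVT_between; last by rewrite /between; lra.
  by move=> x; apply: cvgB; [exact: gc|exact: cvg_id].
have {}gp : g p = p by move: gp => /=; lra.
have qpr : q <= p <= r by move: pb; rewrite /between; lra.
have np n : u n != p.
  by apply/eqP => un; move: (nofix n); rewrite -[u n.+1]/(g (u n)) un gp eqxx.
have Up n : u n < u n.+1 -> u n < p by move=> un; rewrite lt_neqAle np /=; have := Uq n un; lra.
have Dp n : u n.+1 < u n -> p < u n by move=> un; rewrite lt_neqAle eq_sym np /=; have := Dr n un; lra.
have nf2 := @no_fold_iter _ g 2 isT nf.
have gc2 : continuous (iter 2 g) by exact: iter_continuous.
have it2 M n : iter n (iter 2 g) (u M) = u (M + n * 2)%N.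
  by rewrite -iterM /u addnC iterD.
have bnd2 M : exists A B, forall n, A <= iter n (iter 2 g) (u M) <= B.
  by exists A, B => n; rewrite it2; exact: AB.
have na2 M : not_asymptotically_periodic (iter 2 g) (u M).
  by apply: nap_iter => //; exact: nap_shift.
have [M1 NM1 oM1] : exists2 M, (N <= M)%N & odd M = b.
  have [par|par] := eqVneq (odd N) b; first by exists N.
  by exists N.+1 => //=; move: par; case: (odd N); case: (b).
have [M2 NM2 oM2] : exists2 M, (N <= M)%N & odd M = ~~ b.
  by exists M1.+1; [natlia|rewrite /= oM1].
have odd2 M n : odd (M + n * 2) = odd M by rewrite oddD muln2 odd_double addbF.
have [|n|e1 [K1 [e10 H1]]] := nap_bounded_away gc2 nf2 (na2 M1) (bnd2 M1) (p := p).
- by rewrite /= !gp.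
- by rewrite it2; apply: Up; rewrite upE ?odd2 ?oM1 //; natlia.
have [| |n|e2 [K2 [e20 H2]]] := nap_bounded_away (reflect_continuous gc2)
    (no_fold_reflect nf2) (nap_reflect (na2 M2)) _ (p := - p).
- by exists (- B), (- A) => n; rewrite iter_reflect opprK it2 !lerN2 andbC AB.
- by rewrite /reflect_map opprK /= !gp.
- rewrite iter_reflect opprK it2 ltrN2; apply: Dp.
  by rewrite -dnE upE ?odd2 ?oM2 //; [case: (b)|natlia].
exists (M1 + M2 + 2 * (K1 + K2))%N, b, p, (Num.min e1 e2).
split=> [|n nN]; first by rewrite lt_min e10.
have m1 : Num.min e1 e2 <= e1 by rewrite ge_min lexx.
have m2 : Num.min e1 e2 <= e2 by rewrite ge_min lexx orbT.
have half M : odd n = odd M -> (M <= n)%N -> n = (M + ((n - M) %/ 2) * 2)%N.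
  move=> oo Mn; rewrite divnK ?subnKC // dvdn2 oddB // oo addbb //.
case: ifPn => [/eqP on|on].
  have e : n = (M1 + ((n - M1) %/ 2) * 2)%N by apply: half; [rewrite on|natlia].
  have := H1 ((n - M1) %/ 2)%N ltac:(natlia); rewrite it2 -e -/(u n); lra.
have e : n = (M2 + ((n - M2) %/ 2) * 2)%N.
  by apply: half; [move: on; rewrite oM2; case: (odd n); case: (b)|natlia].
have := H2 ((n - M2) %/ 2)%N ltac:(natlia); rewrite iter_reflect opprK it2 -e -/(u n); lra.
Qed.

End Alternation.

(** * Classes of the omega-limit set *)

Lemma modn_double T m i : (0 < T)%N -> m = i %[mod T] ->
  m = i %[mod 2 * T] \/ m = i + T %[mod 2 * T].
Proof.
move=> T0 E; rewrite (divn_eq m T) (divn_eq i T) E.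
set r := (i %% T)%N; set q := (m %/ T)%N; set q' := (i %/ T)%N.
have rT : (r < T)%N by rewrite ltn_mod.
have red p : (p * T + r = odd p * T + r %[mod 2 * T])%N.
  have E' : (p * T + r = p./2 * (2 * T) + (odd p * T + r))%N.
    by rewrite -{1}(odd_double_half p) -muln2; ring.
  by rewrite E' modnMDl.
have -> : (q' * T + r + T = q'.+1 * T + r)%N by rewrite mulSn; ring.
rewrite (red q) (red q') (red q'.+1) /=.
by case: (odd q); case: (odd q'); [left|right|right|left].
Qed.

Lemma modn_pow_succ k m i : m = i %[mod 2 ^ k] ->
  m = i %[mod 2 ^ k.+1] \/ m = i + 2 ^ k %[mod 2 ^ k.+1].
Proof. by rewrite expnS; apply: modn_double; rewrite expn_gt0. Qed.

Lemma modn_pow_le k l m i : (l <= k)%N -> m = i %[mod 2 ^ k] -> m = i %[mod 2 ^ l].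
Proof.
move=> lk E; have d : (2 ^ l %| 2 ^ k)%N by exact: dvdn_exp2l.
by rewrite -(modn_dvdm m d) E modn_dvdm.
Qed.

Section Classes.
Context {R : realType} (F : R -> R) (z : R).
Implicit Types (w a b c p e : R) (k i j m n : nat).

(** What zero entropy and an infinite omega-limit set provide. *)
Definition tame := [/\ continuous F, no_fold F, not_asymptotically_periodic F z &
  forall n, 0 <= iter n F z <= 1].

Local Notation x n := (iter n F z).

(** For k = 0 this is the omega-limit set.  Congruences, rather than orbits of the
    iterate, make the dependence on i periodic by definition. *)
Definition omega_class k i w := forall e, 0 < e -> forall N,
  exists m, [/\ (N <= m)%N, m = i %[mod 2 ^ k] & `|x m - w| < e].

Local Notation Om := omega_class.

Lemma om_mod k i j w : i = j %[mod 2 ^ k] -> Om k i w -> Om k j w.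
Proof. by move=> ij H e e0 N; have [m [? mi ?]] := H e e0 N; exists m; rewrite mi. Qed.

Lemma om_le k l i w : (l <= k)%N -> Om k i w -> Om l i w.
Proof.
move=> lk H e e0 N; have [m [? mi ?]] := H e e0 N; exists m; split=> //.
exact: modn_pow_le mi.
Qed.

Lemma om_split k i w : Om k i w -> Om k.+1 i w \/ Om k.+1 (i + 2 ^ k) w.
Proof.
move=> H; apply: contrapT => /not_orP[/existsNP[e1 /not_implyP[e10 /existsNP[N1 H1]]]].
move=> /existsNP[e2 /not_implyP[e20 /existsNP[N2 H2]]].
have e0 : 0 < Num.min e1 e2 by rewrite lt_min e10.
have [m [Nm mi]] := H _ e0 (N1 + N2)%N; rewrite lt_min => /andP[h1 h2].
by case: (modn_pow_succ mi) => E; [apply: H1|apply: H2]; exists m; split=> //; natlia.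
Qed.

Lemma om_half k i w : Om k.+1 (i + 2 ^ k) w -> Om k i w.
Proof. by move/(om_le (leqnSn k)); apply: om_mod; rewrite modnDr. Qed.

Lemma om_closed k i w :
  (forall e, 0 < e -> exists2 w', Om k i w' & `|w' - w| < e) -> Om k i w.
Proof.
move=> H e e0 N; have e2 : 0 < e / 2 by lra.
have [w' Hw' ww'] := H _ e2; have [m [Nm mi xm]] := Hw' _ e2 N.
by exists m; split=> //; move: xm ww'; rewrite !ltr_norml; lra.
Qed.

Lemma om_near (H : tame) k i e : 0 < e -> exists N, forall m, (N <= m)%N ->
  m = i %[mod 2 ^ k] -> exists2 w, Om k i w & `|x m - w| < e.
Proof.
case: H => _ _ _ bnd e0; apply: contrapT => H.
have {}H N : exists m, [/\ (N <= m)%N, m = i %[mod 2 ^ k] &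
    forall w, Om k i w -> e <= `|x m - w|].
  apply: contrapT => H1; apply: H; exists N => m Nm mi; apply: contrapT => H2.
  apply: H1; exists m; split=> // w Hw; rewrite leNgt; apply/negP => xw; apply: H2.
  by exists w.
have [s Hs] := choice H.
have [l _ Hl] := @bounded_cluster _ (fun n => x (s n)) 0 1 (fun n => bnd _).
have Oml : Om k i l.
  move=> e' e'0 N; have [n Nn xn] := Hl _ e'0 N; have [ns si _] := Hs n.
  by exists (s n); split=> //; exact: leq_trans ns.
have [n _ xn] := Hl _ e0 0%N; have [_ _ /(_ _ Oml)] := Hs n; lra.
Qed.

Lemma om_ex (H : tame) k i : exists w, Om k i w.
Proof.
have [N HN] := om_near H k i ltr01.
have [||w Hw _] := HN (i + N * 2 ^ k)%N; last by exists w.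
  by rewrite (leq_trans _ (leq_addl _ _))// leq_pmulr// expn_gt0.
by rewrite addnC modnMDl.
Qed.

Lemma om_bnd (H : tame) k i w : Om k i w -> 0 <= w <= 1.
Proof.
case: H => _ _ _ bnd Hw; rewrite leNgt [w <= _]leNgt; apply/andP; split; apply/negP => lt.
  have [m [_ _]] := Hw (- w) ltac:(lra) 0%N; have := bnd m; rewrite ltr_norml; lra.
have [m [_ _]] := Hw (w - 1) ltac:(lra) 0%N; have := bnd m; rewrite ltr_norml; lra.
Qed.

Lemma om_map (H : tame) k i w : Om k i w -> Om k i.+1 (F w).
Proof.
case: H => Fc _ _ _ Hw e e0 N; have [d d0 Hd] := @cont_eps _ F w e Fc e0.
have [m [Nm mi xm]] := Hw _ d0 N; exists m.+1; split.
- exact: leqW.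
- by rewrite -addn1 -[in RHS]addn1 -modnDml mi modnDml.
- exact: Hd.
Qed.

Lemma om_iter (H : tame) k i w n : Om k i w -> Om k (n + i) (iter n F w).
Proof. by move=> Hw; elim: n => // n IH; exact: om_map. Qed.

Definition below_class k i j := exists p e, [/\ 0 < e,
  forall w, Om k i w -> w <= p - e & forall w, Om k j w -> p + e <= w].

(** This is [parity_split] for the iterate of F of order 2^k and the orbit of
    x i. *)
Lemma om_sep (H : tame) k i :
  below_class k.+1 i (i + 2 ^ k) \/ below_class k.+1 (i + 2 ^ k) i.
Proof.
case: H => Fc nf na bnd; pose T := (2 ^ k)%N; have T0 : (0 < T)%N by rewrite expn_gt0.
have [|N [b [p [e [e0 Hsp]]]]] := parity_split (@iter_continuous _ _ T Fc)
    (no_fold_iter T0 nf) (nap_iter T0 (@nap_shift _ _ _ i na)).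
  by exists 0, 1 => n; rewrite -iterM -iterD.
have HT n : iter n (iter T F) (iter i F z) = x (n * T + i)%N by rewrite -iterM -iterD.
have times j m : (i + (N + j) * T <= m)%N -> m = i + j * T %[mod 2 ^ k.+1] ->
    exists2 n, (N <= n)%N & m = (n * T + i)%N /\ odd n = odd j.
  move=> im mj; have [d Ed] : exists d, (m = i + j * T + d * (2 * T))%N.
    exists ((m - (i + j * T)) %/ (2 ^ k.+1))%N; rewrite -expnS divnK; last first.
      by rewrite -eqn_mod_dvd ?mj //; nia.
    by rewrite subnKC //; nia.
  exists (j + 2 * d)%N; first by rewrite -(leq_pmul2r T0); nia.
  by split; [nia|rewrite oddD mul2n odd_double addbF].
have low j w : Om k.+1 (i + j * T) w -> odd j = b -> w <= p - e.
  move=> Hw ojb; rewrite leNgt; apply/negP => lt.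
  have [m [im mj xm]] := Hw (w - (p - e)) ltac:(lra) (i + (N + j) * T)%N.
  have [n Nn [En on]] := times _ _ im mj.
  have := Hsp n Nn; rewrite on ojb eqxx HT -En; move: xm; rewrite ltr_norml; lra.
have high j w : Om k.+1 (i + j * T) w -> odd j = ~~ b -> p + e <= w.
  move=> Hw ojb; rewrite leNgt; apply/negP => lt.
  have [m [im mj xm]] := Hw (p + e - w) ltac:(lra) (i + (N + j) * T)%N.
  have [n Nn [En on]] := times _ _ im mj.
  have := Hsp n Nn; rewrite on ojb HT -En; move: xm; rewrite ltr_norml.
  by case: (b) => /=; lra.
have E0 w : Om k.+1 i w -> Om k.+1 (i + 0 * T) w by rewrite mul0n addn0.
have E1 w : Om k.+1 (i + 2 ^ k) w -> Om k.+1 (i + 1 * T) w by rewrite mul1n.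
case: b low high {Hsp} => low high.
  right; exists p, e; split=> // w => [/E1|/E0] Hw; [exact: low Hw _|exact: high Hw _].
left; exists p, e; split=> // w => [/E0|/E1] Hw; [exact: low Hw _|exact: high Hw _].
Qed.

Lemma om_disj (H : tame) k i w : Om k.+1 i w -> Om k.+1 (i + 2 ^ k) w -> False.
Proof.
by move=> H1 H2; case: (om_sep H k i) => -[p [e [e0 L U]]];
  [have := L _ H1; have := U _ H2|have := L _ H2; have := U _ H1]; lra.
Qed.

Lemma om_uniq (H : tame) k i j w : Om k i w -> Om k j w -> i = j %[mod 2 ^ k].
Proof.
elim: k => [|k IH] Hi Hj; first by rewrite expn0 !modn1.
have ij := IH (om_le (leqnSn k) Hi) (om_le (leqnSn k) Hj).
case: (modn_pow_succ ij) => // E; exfalso.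
by apply: om_disj Hj _ => //; exact: om_mod E Hi.
Qed.

Lemma om_root k i w : Om k i w -> Om 0 0 w.
Proof. by move/(om_le (leq0n k)); apply: om_mod; rewrite expn0 !modn1. Qed.

Lemma om_index (H : tame) k w : Om 0 0 w -> exists i, Om k i w.
Proof.
move=> Hw; elim: k => [|k [i Hi]]; first by exists 0%N.
by case: (om_split Hi) => ?; [exists i|exists (i + 2 ^ k)%N].
Qed.

Lemma om_conv (H : tame) k i a b c : Om k i a -> Om k i b -> Om 0 0 c ->
  a <= c <= b -> Om k i c.
Proof.
move=> Ha Hb Hc acb; elim: k i Ha Hb => [|k IH] i Ha Hb.
  by apply: om_mod Hc; rewrite expn0 !modn1.
have := IH i (om_le (leqnSn k) Ha) (om_le (leqnSn k) Hb).
case/om_split => // Hc'; exfalso.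
by case: (om_sep H k i) => -[p [e [e0 L U]]];
  [have := L _ Hb; have := U _ Hc'|have := L _ Hc'; have := U _ Ha]; lra.
Qed.

Lemma om_max (H : tame) k i : exists2 M, Om k i M & forall w, Om k i w -> w <= M.
Proof.
have [w0 Hw0] := om_ex H k i.
have sup_om : has_sup [set w | Om k i w].
  by split; [exists w0|exists 1 => w /(om_bnd H)/andP[]].
exists (sup [set w | Om k i w]); last by move=> w Hw; apply: sup_ubound => //; case: sup_om.
apply: om_closed => e e0; have [w /= Hw we] := sup_adherent e0 sup_om.
exists w => //; have : w <= sup [set w | Om k i w] by apply: sup_ubound => //; case: sup_om.
by rewrite ltr_norml; lra.
Qed.

Lemma om_min (H : tame) k i : exists2 M, Om k i M & forall w, Om k i w -> M <= w.
Proof.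
have [w0 Hw0] := om_ex H k i.
have inf_om : has_inf [set w | Om k i w].
  by split; [exists w0|exists 0 => w /(om_bnd H)/andP[]].
exists (inf [set w | Om k i w]); last by move=> w Hw; apply: inf_lbound => //; case: inf_om.
apply: om_closed => e e0; have [w /= Hw we] := inf_adherent e0 inf_om.
exists w => //; have : inf [set w | Om k i w] <= w by apply: inf_lbound => //; case: inf_om.
by rewrite ltr_norml; lra.
Qed.


End Classes.

(** * Gaps between classes *)

Section Gaps.
Context {R : realType} (F : R -> R) (z : R).
Implicit Types (w a b c p e t u v : R) (k i j m n : nat) (A B C : R * R) (Q : R -> Prop).

Local Notation Om := (omega_class F z).
Local Notation tame := (tame F z).

Definition sbetween u v t := (u < t < v) || (v < t < u).

(** No gap separates such points from each other. *)
Definition same_class a b := forall k i, Om k i a -> Om k i b.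

Lemma same_class_split (H : tame) k i a b : Om k i a -> Om k i b -> ~ same_class a b ->
  exists k' n, [/\ (k <= k')%N, Om k'.+1 n a & Om k'.+1 (n + 2 ^ k') b].
Proof.
move=> Ha Hb ns.
have ex : exists l, `[< exists j, Om l j a /\ ~ Om l j b >].
  apply: contrapT => H1; apply: ns => l j Hl; apply: contrapT => H2; apply: H1.
  by exists l; apply/asboolP; exists j.
case: (ex_minnP ex) => l /asboolP[j [Hja Hjb]] minl.
have kl : (k < l)%N.
  rewrite ltnNge; apply/negP => lk; apply: Hjb.
  have := om_uniq H (om_le lk Ha) Hja => /om_mod; apply; exact: om_le lk Hb.
case: l kl Hja Hjb minl => // l kl Hja Hjb minl; exists l, j; split=> //.
have Hlb : Om l j b.
  apply: contrapT => nb; suff : (l.+1 <= l)%N by rewrite ltnn.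
  apply: minl; apply/asboolP; exists j; split=> //; exact: om_le (leqnSn l) Hja.
by case: (om_split Hlb).
Qed.

(** The point of one half of a class of level k that is nearest to the other half.
    Betweenness makes it unnecessary to know which half is the lower one. *)
Definition facing k n e := Om k.+1 n e /\
  forall w w', Om k.+1 n w -> Om k.+1 (n + 2 ^ k) w' -> between w w' e.

Lemma facing_ex (H : tame) k n : exists e, facing k n e.
Proof.
case: (om_sep H k n) => -[p [d [d0 L U]]].
  have [M HM maxM] := om_max H k.+1 n; exists M; split=> // w w' /maxM wM /U pw'.
  by have := L _ HM; rewrite /between; lra.
have [M HM minM] := om_min H k.+1 n; exists M; split=> // w w' /minM wM /L pw'.
by have := U _ HM; rewrite /between; lra.
Qed.

Definition gap_end k n := xget 0 [set e | facing k n e].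

Local Notation ep := gap_end.

Lemma epP (H : tame) k n : facing k n (ep k n).
Proof. by have := xgetPex 0 (facing_ex H k n). Qed.

Lemma facing_uniq (H : tame) k n e e' : facing k n e -> facing k n e' -> e = e'.
Proof.
move=> [He fe] [He' fe']; have [w' Hw'] := om_ex H k.+1 (n + 2 ^ k).
by have := fe _ _ He' Hw'; have := fe' _ _ He Hw'; rewrite /between; lra.
Qed.

Lemma ep_mod (H : tame) k m n : m = n %[mod 2 ^ k.+1] -> ep k m = ep k n.
Proof.
move=> mn; apply: (facing_uniq H (k := k) (n := n)); last exact: epP.
have [Hm fm] := epP H k m; split=> [|w w' Hw Hw']; first exact: om_mod Hm.
by apply: fm; [apply: om_mod Hw|apply: om_mod Hw'; rewrite -modnDml -mn modnDml].
Qed.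

Lemma ep_om (H : tame) k n : Om k.+1 n (ep k n).
Proof. by case: (epP H k n). Qed.

Lemma ep_om' (H : tame) k n : Om k.+1 (n + 2 ^ k) (ep k (n + 2 ^ k)).
Proof. exact: ep_om. Qed.

Lemma ep_between (H : tame) k n w w' : Om k.+1 n w -> Om k.+1 (n + 2 ^ k) w' ->
  between w w' (ep k n).
Proof. by case: (epP H k n) => _; apply. Qed.

Lemma addn_two_halves k n : (n + 2 ^ k + 2 ^ k = n + 2 ^ k.+1)%N.
Proof. by rewrite -addnA addnn -mul2n -expnS. Qed.

Lemma ep_double (H : tame) k n : ep k (n + 2 ^ k + 2 ^ k) = ep k n.
Proof. by apply: ep_mod => //; rewrite addn_two_halves modnDr. Qed.

Lemma ep_between' (H : tame) k n w w' : Om k.+1 n w -> Om k.+1 (n + 2 ^ k) w' ->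
  between w w' (ep k (n + 2 ^ k)).
Proof.
move=> Hw Hw'; rewrite between_sym; apply: ep_between => //.
by apply: om_mod Hw; rewrite addn_two_halves modnDr.
Qed.

Lemma ep_neq (H : tame) k n : ep k n != ep k (n + 2 ^ k).
Proof.
apply/eqP => E; apply: (@om_disj _ _ _ H k n (ep k n)); first exact: ep_om.
rewrite E; exact: ep_om'.
Qed.

Lemma gap_empty (H : tame) k n w : Om 0 0 w -> ~~ sbetween (ep k n) (ep k (n + 2 ^ k)) w.
Proof.
move=> Hw; apply/negP => sb.
have H1 := om_le (leqnSn k) (ep_om H k n); have H2 := om_half (ep_om' H k n).
have Hk : Om k n w.
  by case/orP: sb => sb; [apply: om_conv H1 H2 Hw _|apply: om_conv H2 H1 Hw _] => //; lra.
case: (om_split Hk) => Hk1.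
  have := ep_between H Hk1 (ep_om' H k n); move: sb; rewrite /between /sbetween; lra.
have := ep_between' H (ep_om H k n) Hk1; move: sb; rewrite /between /sbetween; lra.
Qed.

Lemma gap_between (H : tame) k i a b : Om k i a -> Om k i b -> ~ same_class a b ->
  exists k' n, [/\ (k <= k')%N, Om k'.+1 n a, Om k'.+1 (n + 2 ^ k') b,
    between a b (ep k' n) & between a b (ep k' (n + 2 ^ k'))].
Proof.
move=> Ha Hb ns; have [k' [n [kk' Ha' Hb']]] := same_class_split H Ha Hb ns.
by exists k', n; split=> //; [apply: ep_between|apply: ep_between'].
Qed.

(** The interiors of the gaps contain no point of omega, so they are disjoint and
    only finitely many gaps are long. *)
Lemma gap_small (H : tame) e : 0 < e -> exists k0, forall k n, (k0 <= k)%N ->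
  `|ep k n - ep k (n + 2 ^ k)| < e.
Proof.
move=> e0; apply: contrapT => H1.
have {}H1 k0 : exists kn : nat * nat, (k0 <= kn.1)%N /\
    e <= `|ep kn.1 kn.2 - ep kn.1 (kn.2 + 2 ^ kn.1)|.
  apply: contrapT => H2; apply: H1; exists k0 => k n kk.
  by rewrite ltNge; apply/negP => le; apply: H2; exists (k, n).
have [s Hs] := choice H1.
have lr j : exists lr : R * R, [/\ Om (s j).1.+1 (s j).2 lr.1 /\
      Om (s j).1.+1 ((s j).2 + 2 ^ (s j).1) lr.2 \/ Om (s j).1.+1 (s j).2 lr.2 /\
      Om (s j).1.+1 ((s j).2 + 2 ^ (s j).1) lr.1, lr.1 + e <= lr.2 &
      forall w, Om 0 0 w -> ~~ (lr.1 < w < lr.2)].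
  have [_ ge] := Hs j; set k := (s j).1 in ge *; set n := (s j).2 in ge *.
  have [lt|le] := ltP (ep k n) (ep k (n + 2 ^ k)).
    exists (ep k n, ep k (n + 2 ^ k)); split=> [||w /(gap_empty H k n)] /=.
    - by left; split; [exact: ep_om|exact: ep_om'].
    - by move: ge; rewrite ltr0_norm; lra.
    - by rewrite /sbetween negb_or => /andP[].
  exists (ep k (n + 2 ^ k), ep k n); split=> [||w /(gap_empty H k n)] /=.
  - by right; split; [exact: ep_om|exact: ep_om'].
  - by move: ge; rewrite ger0_norm; lra.
  - by rewrite /sbetween negb_or => /andP[].
have [q Hq] := choice lr.
have omq j : Om 0 0 (q j).1 /\ Om 0 0 (q j).2.
  by case: (Hq j) => -[] [h1 h2] _ _; split; apply: om_root; eassumption.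
have bq j : 0 <= (q j).1 <= 1 by apply: om_bnd H _ _ _ (omq j).1.
have [l _ Hl] := bounded_cluster bq.
have e2 : 0 < e / 2 by lra.
have [j1 _ h1] := Hl _ e2 0%N; have [j2 j12 h2] := Hl _ e2 (s j1).1.+1.
have kk : ((s j1).1 < (s j2).1)%N by apply: leq_trans j12 _; case: (Hs j2).
have [c1 l1 em1] := Hq j1; have [c2 l2 em2] := Hq j2.
have := em1 _ (omq j2).1; have := em2 _ (omq j1).1.
have := em1 _ (omq j2).2; have := em2 _ (omq j1).2.
move: h1 h2; rewrite !ltr_norml => h1 h2 n1 n2 n3 n4.
have E1 : (q j1).1 = (q j2).1 by lra.
have E2 : (q j1).2 = (q j2).2 by lra.
have same : exists i, Om (s j1).1.+1 i (q j1).1 /\ Om (s j1).1.+1 i (q j1).2.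
  exists (s j2).2; rewrite E1 E2.
  by case: c2 => -[a b]; split; apply: (om_le kk); (apply: om_le (leqnSn _) _; eassumption) || (apply: om_half; eassumption).
case: same => i [i1 i2].
case: c1 => -[a b].
  have E := om_uniq H i1 a; apply: (om_disj H (om_mod E i2) b).
have E := om_uniq H i2 a; apply: (om_disj H (om_mod E i1) b).
Qed.

Definition inI A t := between A.1 A.2 t.
Definition inside A u v := forall t, inI A t -> sbetween u v t.

(** F stretches A over B with room to spare, so that nearby maps still stretch A
    over B. *)
Definition cov A B := exists p q, [/\ inI A p, inI A q &
  forall t, inI B t -> F p < t < F q].

Fixpoint reach Q m A B : Prop :=
  if m is m'.+1 then (forall t, inI A t -> Q t) /\ exists2 C, cov A C & reach Q m' C B
  else A = B /\ forall t, inI A t -> Q t.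

Lemma inI_l A : inI A A.1.
Proof. by rewrite /inI /between lexx /=; case: (leP A.1 A.2) => //= /ltW ->. Qed.

Lemma inI_r A : inI A A.2.
Proof. by rewrite /inI /between lexx /=; case: (leP A.1 A.2) => //= /ltW ->. Qed.

Lemma reach_trans Q m n A B C : reach Q m A B -> reach Q n B C -> reach Q (m + n) A C.
Proof.
elim: m A => [|m IH] A /=; first by case=> ->.
by move=> [QA [D AD DB]] BC; split=> //; exists D => //; exact: IH.
Qed.

Lemma reach_sub Q Q' m A B : (forall t, Q t -> Q' t) -> reach Q m A B -> reach Q' m A B.
Proof.
move=> QQ'; elim: m A => [|m IH] A /=; first by case=> -> QA; split=> // t /QA /QQ'.
by move=> [QA [D AD DB]]; split=> [t /QA /QQ' //|]; exists D => //; exact: IH.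
Qed.

Lemma reach_tgt Q m A B : reach Q m A B -> forall t, inI B t -> Q t.
Proof.
elim: m A => [|m IH] A /=; first by case=> -> .
by move=> [_ [D _ DB]]; exact: IH DB.
Qed.

Lemma reach_shrink Q m A B B' : (forall t, inI B' t -> inI B t) ->
  reach Q m.+1 A B -> reach Q m.+1 A B'.
Proof.
move=> BB'; elim: m A => [|m IH] A [QA [C AC CB]]; last by split=> //; exists C => //; exact: IH.
case: CB => CB QC; split=> //; exists B'; last by split=> // t /BB'; rewrite -CB; exact: QC.
have [p [q [Ap Aq pq]]] := AC; exists p, q; split=> // t /BB'; rewrite -CB; exact: pq.
Qed.

(** Inner points near u and v are still mapped beyond the compact interval B. *)
Lemma cov_pull u v B : continuous F -> inside B (F u) (F v) ->
  exists2 A, inside A u v & cov A B.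
Proof.
move=> Fc; wlog uv : u v / F u < F v.
  move=> W ins; have [uv|vu|E] := ltgtP (F u) (F v); first exact: W.
    have [|A Ai AB] := W v u vu.
      by move=> t /ins; rewrite /sbetween orbC.
    by exists A => // t /Ai; rewrite /sbetween orbC.
  by have := ins _ (inI_l B); rewrite /sbetween E; lra.
move=> ins.
have B1 : F u < B.1 < F v by have := ins _ (inI_l B); rewrite /sbetween; lra.
have B2 : F u < B.2 < F v by have := ins _ (inI_r B); rewrite /sbetween; lra.
have uv' : u != v by apply: contraTneq uv => ->; rewrite ltxx.
have near w w' d : 0 < d -> w != w' -> exists2 s, sbetween w w' s & `|s - w| < d.
  move=> d0 ww'; pose r := Num.min (d / 2) (`|w' - w| / 2).
  have n0 : 0 < `|w' - w| by rewrite normr_gt0 subr_eq0 eq_sym.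
  have r0 : 0 < r by rewrite /r lt_min; apply/andP; split; lra.
  have r1 : r <= d / 2 by rewrite /r ge_min lexx.
  have r2 : r <= `|w' - w| / 2 by rewrite /r ge_min lexx orbT.
  have [lt|le] := ltP w w'.
    exists (w + r); last by rewrite ltr_norml; lra.
    by move: r2; rewrite ger0_norm /sbetween; lra.
  exists (w - r); last by rewrite ltr_norml; lra.
  by move: r2; rewrite ler0_norm /sbetween; lra.
pose lo := Num.min B.1 B.2; pose hi := Num.max B.1 B.2.
have lo1 : F u < lo by rewrite lt_min; lra.
have hi1 : hi < F v by rewrite gt_max; lra.
have [d1 d10 Hd1] := @cont_eps _ F u (lo - F u) Fc ltac:(lra).
have [d2 d20 Hd2] := @cont_eps _ F v (F v - hi) Fc ltac:(lra).
have [x xb /Hd1 Fx] := near u v d1 d10 uv'.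
have [y yb /Hd2 Fy] := near v u d2 d20 ltac:(by rewrite eq_sym).
exists (x, y).
  by move=> t; move: xb yb; rewrite /inI /between /sbetween /=; lra.
exists x, y; split; [exact: (inI_l (x, y))|exact: (inI_r (x, y))|move=> t Bt].
have : lo <= t <= hi.
  by move: Bt; rewrite /inI /between /lo /hi ge_min le_max => /orP[] /andP[-> ->]; rewrite ?orbT.
by move: Fx Fy; rewrite !ltr_norml; lra.
Qed.

Lemma reach_pull Q N u v B : continuous F -> inside B (iter N F u) (iter N F v) ->
  (forall i t, (i <= N)%N -> between (iter i F u) (iter i F v) t -> Q t) ->
  exists2 A, inside A u v & reach Q N A B.
Proof.
move=> Fc; elim: N u v => [|N IH] u v ins QH.
  exists B => //; split=> // t /ins sb; apply: (QH 0%N) => //=.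
  by move: sb; rewrite /sbetween /between /=; lra.
have [||A' A'i A'B] := IH (F u) (F v).
- by rewrite -!iterSr.
- by move=> i t iN; rewrite -!iterSr; exact: QH.
have [A Ai AA'] := cov_pull Fc A'i; exists A => //; split; last by exists A'.
move=> t /Ai sb; apply: (QH 0%N) => //=.
by move: sb; rewrite /sbetween /between /=; lra.
Qed.

End Gaps.

(** * Loops of gaps *)

Section Loops.
Context {R : realType} (F : R -> R) (z : R).
Implicit Types (w a b c d p e t u v x y : R) (k i j m n : nat) (A B C : R * R) (Q : R -> Prop).

Local Notation Om := (omega_class F z).
Local Notation tame := (tame F z).
Local Notation ep := (gap_end F z).

Definition lower k n := ep k n < ep k (n + 2 ^ k).
(** The order that points out of the gap at its end numbered n: a is farther out
    than b. *)
Definition beyond k n a b := if lower k n then a < b else b < a.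
Definition mid k n := (ep k n + ep k (n + 2 ^ k)) / 2.
(** Points taken from the two halves of a gap are automatically in the right
    order. *)
Definition half k n x := beyond k n (ep k n) x /\ beyond k n x (mid k n).

Lemma lower_opp (H : tame) k n : lower k (n + 2 ^ k) = ~~ lower k n.
Proof.
rewrite /lower ep_double // -leNgt le_eqVlt [X in X || _]eq_sym.
by rewrite (negbTE (ep_neq H k n)).
Qed.

Lemma mid_opp (H : tame) k n : mid k (n + 2 ^ k) = mid k n.
Proof. by rewrite /mid ep_double // addrC. Qed.

Fixpoint chain k n m c b : Prop :=
  if m is m'.+1 then half k n c /\ exists2 c', beyond k n.+1 (F c) c' & chain k n.+1 m' c' b
  else c = b.

Lemma chain_cat k n m m' c b d : chain k n m c b -> chain k (n + m) m' b d ->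
  chain k n (m + m') c d.
Proof.
elim: m n c => [|m IH] n c /=; first by move=> ->; rewrite addn0.
move=> [hc [c' cc' ch]] bd; split=> //; exists c' => //.
by apply: IH ch _; rewrite addSnnS.
Qed.

Lemma chain_head k n m c b : chain k n m c b -> half k (n + m) b -> half k n c.
Proof. by case: m => [|m] /=; [move=> ->; rewrite addn0|case]. Qed.

(** F maps the two halves of a class into the two halves of the next class. *)
Lemma ep_map_far (H : tame) k n : F (ep k n) = ep k n.+1 \/ beyond k n.+1 (F (ep k n)) (ep k n.+1).
Proof.
have h1 : Om k.+1 n.+1 (F (ep k n)) by apply: om_map => //; exact: ep_om.
have b1 := ep_between H h1 (ep_om' H k n.+1).
have [|ne] := eqVneq (F (ep k n)) (ep k n.+1); [by left|right].
have ne' := ep_neq H k n.+1.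
rewrite /beyond /lower; move: b1 ne ne'; rewrite /between !neq_lt.
by case: (ltP (ep k n.+1) (ep k (n.+1 + 2 ^ k))); lra.
Qed.

Lemma half_near (H : tame) k n x0 : beyond k n (ep k n) x0 ->
  forall e, 0 < e -> exists x, [/\ half k n x, beyond k n x x0 & `|x - ep k n| < e].
Proof.
rewrite /half /beyond /mid; case: ifPn; rewrite /lower => lo x0b e e0.
  pose r := Num.min (e / 2) (Num.min ((x0 - ep k n) / 2) ((ep k (n + 2 ^ k) - ep k n) / 3)).
  have r0 : 0 < r by rewrite !lt_min; apply/and3P; split; lra.
  have r1 : r <= e / 2 by rewrite ge_min lexx.
  have r2 : r <= (x0 - ep k n) / 2 by rewrite !ge_min lexx orbT.
  have r3 : r <= (ep k (n + 2 ^ k) - ep k n) / 3 by rewrite !ge_min lexx !orbT.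
  by exists (ep k n + r); split; [split|..]; rewrite ?ltr_norml; lra.
have lo' : ep k (n + 2 ^ k) < ep k n by rewrite lt_neqAle eq_sym ep_neq // leNgt.
pose r := Num.min (e / 2) (Num.min ((ep k n - x0) / 2) ((ep k n - ep k (n + 2 ^ k)) / 3)).
have r0 : 0 < r by rewrite !lt_min; apply/and3P; split; lra.
have r1 : r <= e / 2 by rewrite ge_min lexx.
have r2 : r <= (ep k n - x0) / 2 by rewrite !ge_min lexx orbT.
have r3 : r <= (ep k n - ep k (n + 2 ^ k)) / 3 by rewrite !ge_min lexx !orbT.
by exists (ep k n - r); split; [split|..]; rewrite ?ltr_norml; lra.
Qed.

Lemma half_ex (H : tame) k n x0 : beyond k n (ep k n) x0 ->
  exists2 x, half k n x & beyond k n x x0.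
Proof. by move/(half_near H)/(_ _ ltr01) => [x [h1 h2 _]]; exists x. Qed.

Lemma beyond_mid (H : tame) k n : beyond k n (ep k n) (mid k n).
Proof.
have := ep_neq H k n; rewrite /beyond /lower /mid neq_lt.
by case: ltP => ?; lra.
Qed.

Lemma pull_end (H : tame) k n b : beyond k n.+1 (F (ep k n)) b ->
  exists2 c, half k n c & beyond k n.+1 (F c) b.
Proof.
have [Fc _ _ _] := H => Fb.
have d0 : 0 < `|b - F (ep k n)|.
  by rewrite normr_gt0 subr_eq0; move: Fb; rewrite /beyond; case: ifP => _ lt; rewrite neq_lt lt ?orbT.
have [d dd Hd] := @cont_eps _ F (ep k n) _ Fc d0.
have [c [hc _ /Hd Fcn]] := half_near H (beyond_mid H k n) dd.
exists c => //; move: Fb Fcn; rewrite /beyond ltr_norml; case: ifP => _ lt.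
  by rewrite ger0_norm; lra.
by rewrite ltr0_norm; lra.
Qed.

Lemma pull_back (H : tame) k n m b : half k (n + m) b ->
  exists2 c, half k n c & chain k n m c b.
Proof.
elim: m n => [|m IH] n; first by rewrite addn0; exists b.
rewrite -addSnnS => /IH[c' hc' ch].
have [|c hc cc'] := @pull_end H k n c'.
  case: hc' => hc' _; case: (ep_map_far H k n) => [->//|].
  by move: hc'; rewrite /beyond; case: ifP => _; lra.
by exists c => //; split=> //; exists c'.
Qed.

(** If the image of each end were in the same class of level k + 2 as the next end,
    then the ends would change their class of level k + 2 after 2^(k+1) steps,
    although they are periodic with that period. *)
Lemma exit_edge (H : tame) k n : exists2 j, (n <= j)%N &
  exists i, Om k.+2 i (ep k j.+1) /\ Om k.+2 (i + 2 ^ k.+1) (F (ep k j)).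
Proof.
apply: contrapT => noex.
have [i Hi] : exists i, Om k.+2 i (ep k n).
  by apply: om_index => //; apply: om_root (ep_om H k n).
have follow r : Om k.+2 (r + i) (ep k (n + r)).
  elim: r => [|r IH]; first by rewrite addn0.
  have HF := om_map H IH; rewrite addnS.
  have Hc : Om k.+1 (r + i).+1 (ep k (n + r).+1).
    apply: om_mod (ep_om H k (n + r).+1).
    have E := om_uniq H (om_le (leqnSn _) IH) (ep_om H k (n + r)).
    by rewrite -[in LHS]addn1 -[in RHS]addn1 -modnDml -E modnDml.
  case: (om_split Hc) => // swap.
  exfalso; apply: noex; exists (n + r)%N; first exact: leq_addr.
  exists ((r + i).+1 + 2 ^ k.+1)%N; split=> //.
  by apply: om_mod HF; rewrite addn_two_halves modnDr.
have := follow (2 ^ k.+1)%N; rewrite addnC => bad.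
apply: (om_disj H Hi); rewrite -[ep k n](ep_mod H (m := (n + 2 ^ k.+1)%N)) ?modnDr//.
Qed.

(** At an exit edge j the image of the end is strictly beyond the next end, so an
    inner point c1 can be chosen whose image is beyond every inner point of the
    next gap.  Later targets are pulled back to the time after j, and c1 is
    pulled back from time j to time n: the resulting point does not depend on
    the target. *)
Lemma side_hub (H : tame) k n : exists c m0, half k n c /\
  forall m b, (m0 <= m)%N -> half k (n + m) b -> chain k n m c b.
Proof.
have [j nj [i [Hi HF]]] := exit_edge H k n.
have [ne|strict] := ep_map_far H k j.
  by exfalso; apply: om_disj HF => //; rewrite ne.
have [c1 hc1 str] := pull_end H strict.
have [|c hc ch] := @pull_back H k n (j - n) c1; first by rewrite subnKC.
exists c, (j - n).+1; split=> // m b jm hb.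
have -> : m = ((j - n) + (m - (j - n)))%N by rewrite subnKC // ltnW.
apply: chain_cat ch _; rewrite subnKC //.
have -> : (m - (j - n) = (m - (j - n)).-1.+1)%N by rewrite prednK // subn_gt0.
split=> //.
have [|c' hc' ch'] := @pull_back H k j.+1 (m - (j - n)).-1 b.
  by have -> : (j.+1 + (m - (j - n)).-1 = n + m)%N by natlia.
exists c' => //; case: hc' => hc' _.
by move: str hc'; rewrite /beyond; case: ifP => _; lra.
Qed.

Definition gap_in Q k := forall n t, between (ep k n) (ep k (n + 2 ^ k)) t -> Q t.

(** An interval in the gap from which all intervals inside sufficiently late gaps of
    level k are reached.  Robust loops alone would not do: an interval from which
    a given target is reached depends on that target, which depends on the
    targets of higher levels, and so on without end.  A hub depends on its level
    only. *)
Definition hub Q k n C m0 := inside C (ep k n) (ep k (n + 2 ^ k)) /\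
  forall m B, (m0 <= m)%N -> inside B (ep k (n + m)) (ep k (n + m + 2 ^ k)) ->
    reach F Q m C B.

Lemma halves_inside (H : tame) k n c d : half k n c -> half k (n + 2 ^ k) d ->
  inside (c, d) (ep k n) (ep k (n + 2 ^ k)).
Proof.
rewrite /half /beyond mid_opp // lower_opp // /lower /mid.
case: ltP => /= lo [h1 h2] [h3 h4] t; rewrite /inI /between /sbetween /=.
  lra.
have lo' : ep k (n + 2 ^ k) < ep k n by rewrite lt_neqAle eq_sym ep_neq.
lra.
Qed.

Lemma halves_reach (H : tame) Q k n m c d b b' : gap_in Q k ->
  half k (n + m) b -> half k (n + 2 ^ k + m) b' ->
  chain k n m c b -> chain k (n + 2 ^ k) m d b' ->
  reach F Q m (c, d) (b, b').
Proof.
move=> QG; elim: m n c d => [|m IH] n c d.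
  rewrite !addn0 => hb hb' /= -> ->; split=> // t /(halves_inside H hb hb') sb.
  by apply: (QG n); move: sb; rewrite /sbetween /between; lra.
move=> hb hb' [hc [c' cc' ch]] [hd [d' dd' ch']].
split=> [t /(halves_inside H hc hd) sb|].
  by apply: (QG n); move: sb; rewrite /sbetween /between; lra.
rewrite -addSnnS in hb; rewrite -addSnnS -addSn in hb'; rewrite -addSn in ch' dd'.
exists (c', d'); last exact: IH _ _ _ hb hb' ch ch'.
have hc' := chain_head ch hb; have hd' := chain_head ch' hb'.
move: hc' hd' cc' dd'; rewrite /half /beyond mid_opp // lower_opp //.
case: ifP => _ /= [_ h1] [_ h2] h3 h4.
  exists c, d; split; [exact: (inI_l (c, d))|exact: (inI_r (c, d))|].
  by move=> t; rewrite /inI /between /=; lra.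
exists d, c; split; [exact: (inI_r (c, d))|exact: (inI_l (c, d))|].
by move=> t; rewrite /inI /between /=; lra.
Qed.

Lemma hub_ex (H : tame) Q k n : gap_in Q k -> exists C m0, hub Q k n C m0.
Proof.
move=> QG; have [c [m1 [hc Hc]]] := side_hub H k n.
have [d [m2 [hd Hd]]] := side_hub H k (n + 2 ^ k).
exists (c, d), (m1 + m2).+1; split=> [|m B mm Bi]; first exact: halves_inside.
pose lo := Num.min B.1 B.2; pose hi := Num.max B.1 B.2.
have BI t : inI B t -> lo <= t <= hi.
  by rewrite /inI /between /lo /hi ge_min le_max => /orP[] /andP[-> ->]; rewrite ?orbT.
have slo : sbetween (ep k (n + m)) (ep k (n + m + 2 ^ k)) lo.
  by rewrite /lo minElt; case: ifP => _; apply: Bi; [exact: inI_l|exact: inI_r].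
have shi : sbetween (ep k (n + m)) (ep k (n + m + 2 ^ k)) hi.
  by rewrite /hi maxElt; case: ifP => _; apply: Bi; [exact: inI_r|exact: inI_l].
have lohi : lo <= hi by rewrite /lo /hi ge_min le_max lexx.
have [b [b' [hb hb' Bb]]] : exists b b', [/\ half k (n + m) b, half k (n + m + 2 ^ k) b' &
    forall t, inI B t -> inI (b, b') t].
  have [lw|lw] := boolP (lower k (n + m)).
    have lw' : ep k (n + m) < ep k (n + m + 2 ^ k) by [].
    have [|b hb bb] := @half_ex H k (n + m) lo.
      by move: slo; rewrite /beyond lw /sbetween; lra.
    have [|b' hb' bb'] := @half_ex H k (n + m + 2 ^ k) hi.
      by move: shi; rewrite /beyond lower_opp // lw /= /sbetween; lra.
    exists b, b'; split=> // t /BI; move: bb bb'; rewrite /beyond lower_opp // lw /=.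
    by rewrite /inI /between /=; lra.
  have lw' : ep k (n + m + 2 ^ k) < ep k (n + m).
    by rewrite lt_neqAle eq_sym ep_neq //= leNgt.
  have [|b hb bb] := @half_ex H k (n + m) hi.
    by move: shi; rewrite /beyond (negbTE lw) /sbetween; lra.
  have [|b' hb' bb'] := @half_ex H k (n + m + 2 ^ k) lo.
    by move: slo; rewrite /beyond lower_opp // (negbTE lw) /= /sbetween; lra.
  exists b, b'; split=> // t /BI; move: bb bb'; rewrite /beyond lower_opp // (negbTE lw) /=.
  by rewrite /inI /between /=; lra.
have E : (n + m + 2 ^ k = n + 2 ^ k + m)%N by rewrite addnAC.
rewrite E in hb'.
have r : reach F Q m (c, d) (b, b').
  have mm1 : (m1 <= m)%N by natlia.
  have mm2 : (m2 <= m)%N by natlia.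
  have X := halves_reach H QG hb hb'.
  exact: X (Hc _ _ mm1 hb) (Hd _ _ mm2 hb').
by case: m mm r {Bi slo shi hb hb' E} => // m _ r; exact: reach_shrink r.
Qed.

(** At an exit edge the image of the gap passes over a whole gap of the next
    level. *)
Lemma exit_step (H : tame) k n : exists2 j, (n <= j)%N & exists i, forall B,
  inside B (ep k.+1 i) (ep k.+1 (i + 2 ^ k.+1)) ->
  exists2 A, inside A (ep k j) (ep k (j + 2 ^ k)) & cov F A B.
Proof.
have [j nj [i [Hi HF]]] := exit_edge H k n.
exists j => //; exists i => B Bi.
have [Fc _ _ _] := H; apply: cov_pull => // t /Bi sb.
have h1 := ep_between H Hi HF; have h2 := ep_between' H Hi HF.
have HF1 : Om k.+1 j.+1 (F (ep k j)) by apply: om_map => //; exact: ep_om.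
have HF2 : Om k.+1 (j.+1 + 2 ^ k) (F (ep k (j + 2 ^ k))).
  by rewrite addSn; apply: om_map => //; exact: ep_om'.
have := ep_between H HF1 HF2.
by move: sb h1 h2; rewrite /sbetween /between; lra.
Qed.

Definition gapset k t := exists n, between (ep k n) (ep k (n + 2 ^ k)) t.

Lemma gap_in_gapset k : gap_in (gapset k) k.
Proof. by move=> n t; exists n. Qed.

Lemma hub_up (H : tame) Q k n C m0 : gap_in Q k -> gap_in Q k.+1 -> hub (gapset k) k n C m0 ->
  exists i C' m0' m, hub (gapset k.+1) k.+1 i C' m0' /\ reach F Q m.+1 C C'.
Proof.
move=> Qk Qk1 [Ci HC]; have [j nj [i Hj]] := exit_step H k (n + m0).
have [C' [m0' HC']] := hub_ex H i (@gap_in_gapset k.+1).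
have [A Ai AC'] := Hj C' HC'.1.
have rA : reach F Q (j - n) C A.
  apply: (@reach_sub _ _ (gapset k)); first by move=> t [l]; exact: Qk.
  by apply: HC; [natlia|rewrite subnKC; [exact: Ai|natlia]].
exists i, C', m0', (j - n)%N; split=> //; rewrite -addn1; apply: (reach_trans rA).
split; first exact: reach_tgt rA.
exists C' => //; split=> // t /(HC'.1) sb; apply: (Qk1 i).
by move: sb; rewrite /sbetween /between; lra.
Qed.

Lemma hub_loop Q k n C m0 : tame -> hub Q k n C m0 -> exists m, reach F Q m.+1 C C.
Proof.
move=> H [Ci HC]; exists (m0.+1 * 2 ^ k.+1).-1; rewrite prednK; last first.
  by rewrite muln_gt0 expn_gt0.
have E : (n + m0.+1 * 2 ^ k.+1 = n %[mod 2 ^ k.+1])%N by rewrite addnC modnMDl.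
apply: HC; first by rewrite (leq_trans (leqnSn _))// leq_pmulr // expn_gt0.
rewrite (ep_mod H E) [ep k (_ + _ + _)](ep_mod H (n := (n + 2 ^ k)%N)) //.
by rewrite -modnDml E modnDml.
Qed.

End Loops.

(** * Points in the same class at every level *)

Section Excursions.
Context {R : realType} (F : R -> R) (z : R).
Implicit Types (w a b c d g p e t u v y : R) (k i j m n : nat) (A B C M : R * R).

Local Notation Om := (omega_class F z).
Local Notation tame := (tame F z).
Local Notation ep := (gap_end F z).
Local Notation same_class := (same_class F z).
Local Notation x n := (iter n F z).

Lemma modn_all_eq m n : (forall k, m = n %[mod 2 ^ k]) -> m = n.
Proof.
move=> E; have := E (m + n)%N; rewrite !modn_small //.
  exact: leq_ltn_trans (leq_addl _ _) (ltn_expl _ _).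
exact: leq_ltn_trans (leq_addr _ _) (ltn_expl _ _).
Qed.

Lemma om_not_periodic (H : tame) w r : Om 0 0 w -> iter r F w = w -> r = 0%N.
Proof.
move=> Hw per; apply: modn_all_eq => k; have [i Hi] := om_index H k Hw.
have := om_iter H r Hi; rewrite per => Hi'; have /eqP := om_uniq H Hi' Hi.
by rewrite -{2}[i]add0n eqn_modDr => /eqP.
Qed.

Lemma same_sym (H : tame) a b : Om 0 0 a -> same_class a b -> same_class b a.
Proof.
move=> Ha ab k i Hb; have [j Hj] := om_index H k Ha.
by apply: (om_mod _ Hj); apply: (om_uniq H (ab _ _ Hj) Hb).
Qed.

Lemma same_om a b : Om 0 0 a -> same_class a b -> Om 0 0 b.
Proof. by move=> Ha; apply. Qed.

(** Cluster points along an arbitrary set of times, to be refined by residues as in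
    [cluster_class]. *)
Definition cluster_along (P : nat -> Prop) w := forall e, 0 < e -> forall N,
  exists m, [/\ (N <= m)%N, P m & `|x m - w| < e].

Lemma cluster_split P Q w : cluster_along P w ->
  cluster_along (fun m => P m /\ Q m) w \/ cluster_along (fun m => P m /\ ~ Q m) w.
Proof.
move=> H; apply: contrapT => /not_orP[/existsNP[e1 /not_implyP[e10 /existsNP[N1 H1]]]].
move=> /existsNP[e2 /not_implyP[e20 /existsNP[N2 H2]]].
have e0 : 0 < Num.min e1 e2 by rewrite lt_min e10.
have [m [Nm Pm]] := H _ e0 (N1 + N2)%N; rewrite lt_min => /andP[h1 h2].
by have [Qm|nQm] := pselect (Q m); [apply: H1|apply: H2]; exists m; split=> //; natlia.
Qed.

Lemma cluster_class P k w : cluster_along P w ->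
  exists i, cluster_along (fun m => P m /\ m = i %[mod 2 ^ k]) w.
Proof.
elim: k => [|k IH] Hw.
  exists 0%N => e e0 N; have [m [? ? ?]] := Hw e e0 N.
  by exists m; split=> //; split=> //; rewrite expn0 !modn1.
have [i Hi] := IH Hw.
case: (cluster_split (fun m => m = i %[mod 2 ^ k.+1]) Hi) => Hi'.
  by exists i => e e0 N; have [m [? [[? ?] ?] ?]] := Hi' e e0 N; exists m.
exists (i + 2 ^ k)%N => e e0 N; have [m [? [[? mi] nmi] ?]] := Hi' e e0 N.
by exists m; split=> //; split=> //; case: (modn_pow_succ mi) => // /nmi.
Qed.

Lemma om_times (H : tame) k w : Om 0 0 w -> exists d N, 0 < d /\
  forall m, (N <= m)%N -> `|x m - w| < d -> Om k m w.
Proof.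
move=> Hw; apply: contrapT => H1.
have cl : cluster_along (fun m => ~ Om k m w) w.
  move=> e e0 N; apply: contrapT => H2; apply: H1; exists e, N; split=> // m Nm xm.
  by apply: contrapT => nm; apply: H2; exists m.
have [i Hi] := cluster_class k cl.
have Omi : Om k i w by move=> e e0 N; have [m [? [_ ?] ?]] := Hi e e0 N; exists m.
have [m [_ [nm mi] _]] := Hi 1 ltr01 0%N; apply: nm.
exact: om_mod (esym mi) Omi.
Qed.

Lemma om_near_all (H : tame) k e : 0 < e -> exists N, forall m, (N <= m)%N ->
  exists2 w, Om k m w & `|x m - w| < e.
Proof.
move=> e0; apply: contrapT => H1.
pose P m := forall w, Om k m w -> e <= `|x m - w|.
have H2 N : exists m, (N <= m)%N /\ P m.
  apply: contrapT => H2; apply: H1; exists N => m Nm; apply: contrapT => H3.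
  apply: H2; exists m; split=> // w Hw; rewrite leNgt; apply/negP => xw; apply: H3.
  by exists w.
have [s Hs] := choice H2.
have [_ _ _ bnd] := H.
have [l _ Hl] := @bounded_cluster _ (fun n => x (s n)) 0 1 (fun n => bnd _).
have cl : cluster_along P l.
  move=> e' e'0 N; have [n Nn xn] := Hl _ e'0 N; have [ns Ps] := Hs n.
  by exists (s n); split=> //; exact: leq_trans ns.
have [i Hi] := cluster_class k cl.
have Omi : Om k i l by move=> e' e'0 N; have [m [? [_ ?] ?]] := Hi e' e'0 N; exists m.
have [m [_ [Pm mi] xm]] := Hi e e0 0%N.
have := Pm l (om_mod (esym mi) Omi); lra.
Qed.

(** Otherwise let k + 1 be the first level at which n is not a time of the class of
    c; say that the class of n is above d.  Let m be a late time at which the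
    orbit is near c, below x n, and let r = m - n.  Then F^r maps x n to x m,
    while it maps d and x m into or near the class of n, hence above d: this is
    a fold on x m < x n < d. *)
Lemma visit_class (H : tame) c d n : Om 0 0 c -> same_class c d ->
  c < x n < d -> forall k, Om k n c.
Proof.
move=> Hc cd xn; apply: contrapT => H1.
have ex : exists k, `[< ~ Om k n c >].
  by apply: contrapT => H2; apply: H1 => k; apply: contrapT => H3; apply: H2; exists k; apply/asboolP.
case: (ex_minnP ex) => k /asboolP nk mink.
case: k nk mink => [nk _|k nk mink]; first by apply: nk; apply: om_mod Hc; rewrite expn0 !modn1.
have Hk : Om k n c.
  apply: contrapT => h; suff : (k < k)%N by rewrite ltnn.
  by apply: mink; apply/asboolP.
have Hkc : Om k.+1 (n + 2 ^ k) c by case: (om_split Hk).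
have Hkd := cd _ _ Hkc.
have [Fc nf _ _] := H.
(* The time r = m - n leads from the class of c to that of n. *)
have arith m : m = n + 2 ^ k %[mod 2 ^ k.+1] -> (n <= m)%N ->
    (m - n + m = n %[mod 2 ^ k.+1])%N /\ (m - n + (n + 2 ^ k) = n %[mod 2 ^ k.+1])%N.
  move=> E nm; have Em : (m + 2 ^ k = n %[mod 2 ^ k.+1])%N.
    by rewrite -modnDml E modnDml addn_two_halves modnDr.
  split; last by rewrite addnA subnK.
  apply/eqP; rewrite -(eqn_modDr n) addnAC subnK // -modnDml E modnDml -modnDmr E modnDmr.
  by apply/eqP; rewrite addnACA [(2 ^ k + 2 ^ k)%N]addnn -mul2n -expnS modnDr.
case: (om_sep H k n) => -[p [e [e0 L U]]].
  have [N1 HN1] := om_near H k.+1 n e0.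
  have [m [Nm mn xm]] := Hkd (d - x n) ltac:(lra) (N1 + n).+1.
  have nm : (n < m)%N by natlia.
  have [E1 E2] := arith m mn (ltnW nm).
  have [w Hw xw] := HN1 (m - n + m)%N ltac:(natlia) E1.
  have cp := U _ Hkc; have wp := L _ Hw.
  have Fcl : iter (m - n) F c <= p - e by apply: L; apply: om_mod E2 _; exact: om_iter Hkc.
  have mn0 : (0 < m - n)%N by rewrite subn_gt0.
  have ltcx : c < x n by lra.
  have ltxm : x n < x m by move: xm; rewrite ltr_norml; lra.
  have [_] := nf _ _ _ _ mn0 ltcx ltxm; apply; rewrite -!iterD (subnK (ltnW nm)) lexx.
  by split=> //; move: xw; rewrite ?ltr_norml; lra.
have [N1 HN1] := om_near H k.+1 n e0.
have [m [Nm mn xm]] := Hkc (x n - c) ltac:(lra) (N1 + n).+1.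
have nm : (n < m)%N by natlia.
have [E1 E2] := arith m mn (ltnW nm).
have [w Hw xw] := HN1 (m - n + m)%N ltac:(natlia) E1.
have cp := L _ Hkd; have wp := U _ Hw.
have Fcl : p + e <= iter (m - n) F d by apply: U; apply: om_mod E2 _; exact: om_iter Hkd.
have mn0 : (0 < m - n)%N by rewrite subn_gt0.
have ltcx : x n < d by lra.
have ltxm : x m < x n by move: xm; rewrite ltr_norml; lra.
have [h _] := nf _ _ _ _ mn0 ltxm ltcx; apply: h; rewrite -!iterD (subnK (ltnW nm)) lexx.
by split=> //; move: xw; rewrite ?ltr_norml; lra.
Qed.

Lemma visit_once (H : tame) c d m n : Om 0 0 c -> same_class c d ->
  sbetween c d (x m) -> sbetween c d (x n) -> m = n.
Proof.
move=> Hc cd; have Hd := same_om Hc cd; have dc := same_sym H Hc cd => xm xn.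
have [Hm Hn] : (forall k, Om k m c) /\ (forall k, Om k n c).
  have [lt|lt] : c < d \/ d < c by move: xm; rewrite /sbetween; lra.
    by split; apply: (@visit_class H c d) => //; move: xm xn; rewrite /sbetween; lra.
  by split=> k; apply: (dc k); apply: (@visit_class H d c) => //; move: xm xn; rewrite /sbetween; lra.
by apply: modn_all_eq => k; exact: (om_uniq H (Hm k) (Hn k)).
Qed.

(** The orbit would visit the hull more than once. *)
Lemma class_hull_empty (H : tame) c d w : Om 0 0 c -> same_class c d -> Om 0 0 w ->
  ~~ sbetween c d w.
Proof.
move=> Hc cd Hw; apply/negP => sb.
pose e := Num.min `|w - c| `|d - w|.
have e0 : 0 < e.
  by rewrite lt_min !normr_gt0 !subr_eq0 !neq_lt; move: sb; rewrite /sbetween; lra.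
have in_hull m : `|x m - w| < e -> sbetween c d (x m).
  rewrite lt_min => /andP[]; case/orP: sb => sb; rewrite /sbetween.
    by rewrite (@gtr0_norm _ (w - c)) 1?(@gtr0_norm _ (d - w)) ?ltr_norml; lra.
  by rewrite (@ltr0_norm _ (w - c)) 1?(@ltr0_norm _ (d - w)) ?ltr_norml; lra.
have [m [_ _ xm]] := Hw e e0 0%N; have [n [mn _ xn]] := Hw e e0 m.+1.
have E := visit_once H Hc cd (in_hull _ xm) (in_hull _ xn).
by rewrite E ltnn in mn.
Qed.

(** The images of v are in distinct classes, so that the hulls of such pairs are
    disjoint by [class_hull_empty]; only finitely many are long. *)
Lemma far_mates_bounded (H : tame) v e : Om 0 0 v -> 0 < e -> exists I0, forall i g,
  (I0 <= i)%N -> same_class (iter i F v) g -> `|g - iter i F v| < e.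
Proof.
move=> Hv e0; apply: contrapT => H1.
have Hvi i : Om 0 0 (iter i F v) by apply: om_root; exact: om_iter Hv.
have {}H1 j : exists ig : nat * R, [/\ (j <= ig.1)%N, same_class (iter ig.1 F v) ig.2 &
    e <= `|ig.2 - iter ig.1 F v|].
  apply: contrapT => H2; apply: H1; exists j => i g ji cg; rewrite ltNge; apply/negP => le.
  by apply: H2; exists (i, g).
have [s Hs] := choice H1.
have lr j : exists lr : R * R, [/\ same_class (iter (s j).1 F v) lr.1, same_class lr.1 lr.2 & lr.1 + e <= lr.2].
  have [_ cg le] := Hs j; have [lt|ge] := ltP (s j).2 (iter (s j).1 F v).
    exists ((s j).2, iter (s j).1 F v); split=> //=; first exact: same_sym cg.
    by move: le; rewrite ltr0_norm; lra.
  exists (iter (s j).1 F v, (s j).2); split=> //=.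
  by move: le; rewrite ger0_norm; lra.
have [q Hq] := choice lr.
have omq j : Om 0 0 (q j).1 by case: (Hq j) => /same_om h _ _; exact: h.
have bq j : 0 <= (q j).1 <= 1 by apply: om_bnd H _ _ _ (omq j).
have [l _ Hl] := bounded_cluster bq.
have [j1 _ h1] := Hl (e / 2) ltac:(lra) 0%N.
have [j2 j12 h2] := Hl (e / 2) ltac:(lra) (s j1).1.+1.
have ii : ((s j1).1 < (s j2).1)%N by apply: leq_trans j12 _; case: (Hs j2).
have [c1 l1 le1] := Hq j1; have [c2 l2 le2] := Hq j2.
have := class_hull_empty H (omq j1) l1 (omq j2).
have := class_hull_empty H (omq j2) l2 (omq j1).
move: h1 h2; rewrite /sbetween !ltr_norml => h1 h2 n1 n2.
have E1 : (q j1).1 = (q j2).1 by lra.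
suff E : (s j1).1 = (s j2).1 by rewrite E ltnn in ii.
apply: modn_all_eq => k; have [i Hi] := om_index H k Hv.
have a := c1 _ _ (om_iter H (s j1).1 Hi); have b := c2 _ _ (om_iter H (s j2).1 Hi).
rewrite E1 in a; have /eqP := om_uniq H a b.
by rewrite eqn_modDr => /eqP.
Qed.

End Excursions.

(** * Segments near the omega-limit set *)

Section Visits.
Context {R : realType} (F : R -> R) (z : R).
Implicit Types (w a b c d g p e t u v y : R) (k i j m n : nat) (A B C M : R * R).

Local Notation Om := (omega_class F z).
Local Notation tame := (tame F z).
Local Notation ep := (gap_end F z).
Local Notation same_class := (same_class F z).
Local Notation x n := (iter n F z).

Definition near_om e t := exists2 w, Om 0 0 w & `|t - w| < e.

Definition small_gaps e k0 := forall k n, (k0 <= k)%N -> `|ep k n - ep k (n + 2 ^ k)| < e.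

Lemma small_gap_in (H : tame) e k0 k : small_gaps e k0 -> (k0 <= k)%N -> gap_in F z (near_om e) k.
Proof.
move=> sm kk n t tb; exists (ep k n); first by apply: (om_root (ep_om H k n)).
have := sm k n kk; move: tb; rewrite /between !ltr_norml; lra.
Qed.

Lemma om_nearest (H : tame) o v t : Om 0 0 o -> Om 0 0 v -> o <= t <= v ->
  exists g g', [/\ Om 0 0 g, Om 0 0 g', o <= g <= t, t <= g' <= v &
    forall w, Om 0 0 w -> ~~ (g < w < g') || (w == t)].
Proof.
move=> Ho Hv otv.
pose S := [set w | Om 0 0 w /\ w <= t]; pose S' := [set w | Om 0 0 w /\ t <= w].
have So : S o by split=> //; lra.
have Sv : S' v by split=> //; lra.
have supS : has_sup S by split; [exists o|exists t => w []].
have infS : has_inf S' by split; [exists v|exists t => w []].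
have gt : sup S <= t by apply: sup_le_ub; [case: supS|move=> w []].
have tg' : t <= inf S' by apply: lb_le_inf; [case: infS|move=> w []].
have Sle w : S w -> w <= sup S by move=> Sw; apply: sup_ubound => //; case: supS.
have leS' w : S' w -> inf S' <= w by move=> Sw; apply: inf_lbound => //; case: infS.
exists (sup S), (inf S'); split.
- apply: om_closed => e e0; have [w Sw we] := sup_adherent e0 supS.
  by exists w; [case: Sw|have := Sle _ Sw; rewrite ltr_norml; lra].
- apply: om_closed => e e0; have [w Sw we] := inf_adherent e0 infS.
  by exists w; [case: Sw|have := leS' _ Sw; rewrite ltr_norml; lra].
- by rewrite Sle.
- by rewrite tg' leS'.
move=> w Hw; have [lt|gtw|->] := ltgtP w t; last by rewrite orbT.
  by apply/orP; left; have : w <= sup S by [apply: Sle; split=> //; exact: ltW]; lra.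
by apply/orP; left; have : inf S' <= w by [apply: leS'; split=> //; exact: ltW]; lra.
Qed.

(** The points of omega nearest to t on both sides span a complementary interval of
    omega.  If some level separated them it would be a gap, and too short. *)
Lemma long_gap_mates (H : tame) e k0 k j o v t : small_gaps e k0 -> (k0 <= k)%N -> 0 < e ->
  Om k j o -> Om k j v -> between o v t -> ~ near_om e t ->
  exists g g', [/\ Om k j g /\ Om k j g', same_class g g', between o t g, between t v g' &
    between g g' t /\ e <= `|g - g'|].
Proof.
move=> sm kk e0; wlog ov : o v / o <= v.
  move=> W Ho Hv ovt nt; have [le|/ltW le] := leP o v; first exact: W.
  have [|g [g' [[Hg Hg'] gg' b1 b2 [b3 b4]]]] := W v o le Hv Ho _ nt.
    by rewrite between_sym.
  exists g', g; split=> //; first 3 last.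
  - by rewrite between_sym distrC.
  - exact: same_sym (om_root Hg) gg'.
  - by rewrite between_sym.
  - by rewrite between_sym.
move=> Ho Hv ovt nt.
have otv : o <= t <= v by move: ovt; rewrite /between; lra.
have [g [g' [Hg Hg' og gv empty]]] := om_nearest H (om_root Ho) (om_root Hv) otv.
have far w : Om 0 0 w -> e <= `|t - w|.
  by move=> Hw; rewrite leNgt; apply/negP => lt; apply: nt; exists w.
have gt : g + e <= t by have := far _ Hg; rewrite ger0_norm; lra.
have tg : t + e <= g' by have := far _ Hg'; rewrite ler0_norm; lra.
have Hgk : Om k j g by apply: (om_conv H Ho Hv Hg); lra.
have Hgk' : Om k j g' by apply: (om_conv H Ho Hv Hg'); lra.
exists g, g'; split=> //; first 3 last.
- by split; [rewrite /between; lra|rewrite ltr0_norm; lra].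
- apply: contrapT => ns.
  have [k' [n [kk' Hn Hn' b1 b2]]] := gap_between H Hgk Hgk' ns.
  have lt := sm k' n (leq_trans kk kk').
  have endp w : Om 0 0 w -> between g g' w -> w = g \/ w = g'.
    move=> Hw bw; have := empty w Hw; have := far w Hw.
    have [->|wt] := eqVneq w t; first by rewrite subrr normr0; lra.
    rewrite orbF => _; move: bw; rewrite /between => bw ne.
    have [->|ng] := eqVneq w g; first by left.
    have [->|ng'] := eqVneq w g'; first by right.
    by move: ng ng'; rewrite !neq_lt; lra.
  have ne := ep_neq H k' n.
  have [E1|E1] := endp _ (om_root (ep_om H k' n)) b1;
    have [E2|E2] := endp _ (om_root (ep_om' H k' n)) b2;
    move: lt ne; rewrite E1 E2 ?eqxx // => lt _; move: lt.
    by rewrite ltr0_norm; lra.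
  by rewrite gtr0_norm; lra.
- by rewrite /between; lra.
- by rewrite /between; lra.
Qed.

Definition contains_gap k0 u v := exists k n, [/\ (k0 <= k)%N, between u v (ep k n) &
  between u v (ep k (n + 2 ^ k))].

(** By [long_gap_mates], a point of the segment that is far from omega lies between
    two points g and g' of the same class at every level, g' being on the side
    of v.  Either g' and v are separated by a gap, which the segment contains, or
    else v = g' has the far companion g. *)
Lemma segment_near_om (H : tame) e k0 i o u v : small_gaps e k0 -> 0 < e ->
  Om k0 i o -> Om k0 i v -> `|u - o| < e ->
  (forall g, same_class v g -> `|g - v| < e) ->
  ~ contains_gap k0 u v -> forall t, between u v t -> near_om e t.
Proof.
move=> sm e0 Ho Hv uo mates nogap t tb; apply: contrapT => nt.
have far w : Om 0 0 w -> e <= `|t - w|.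
  by move=> Hw; rewrite leNgt; apply/negP => lt; apply: nt; exists w.
have otv : between o v t.
  have := far _ (om_root Ho); move: tb uo; rewrite /between => tb uo fo.
  by move: fo uo; case: (ltP t o) => lt; [rewrite ltr0_norm|rewrite ger0_norm]; rewrite ?ltr_norml; lra.
have [g [g' [[Hg Hg'] gg' b1 b2 [b3 b4]]]] := long_gap_mates H sm (leqnn _) e0 Ho Hv otv nt.
have g'g := same_sym H (om_root Hg) gg'.
have [s|ns] := pselect (same_class g' v).
  have [E|ne] := eqVneq g' v.
    by have := mates g; rewrite -E => /(_ g'g); lra.
  have gv : same_class g v by move=> k l /gg' /s.
  have := class_hull_empty H (om_root Hg) gv (om_root Hg').
  have t1 := far _ (om_root Hg); have t2 := far _ (om_root Hg').
  have tg : t != g by apply: contraTneq t1 => ->; rewrite subrr normr0; lra.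
  have tg' : t != g' by apply: contraTneq t2 => ->; rewrite subrr normr0; lra.
  by move: ne tg tg' b2 b3; rewrite /sbetween /between !neq_lt; lra.
apply: nogap; have [k [n [kk Hk Hk' c1 c2]]] := gap_between H Hg' Hv ns.
exists k, n; split=> //; move: b2 tb c1 c2; rewrite /between; lra.
Qed.

(** At some level K >= k0 the time m and the point v are first in different halves.
    Later, the orbit follows one half, while F^i v stays in the other half, in
    whose two halves of level K + 2 it alternates.  At one of the times i and
    i + 2^(K+1) it is in the one farther from the orbit, and then the gap of
    level K + 1 lies between. *)
Lemma segment_contains_gap (H : tame) k0 v m n0 : Om k0 m v ->
  ~ (forall k, Om k m v) -> exists2 i, (n0 < i)%N & contains_gap k0 (x (i + m)) (iter i F v).
Proof.
move=> Hv nv.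
have ex : exists k, `[< ~ Om k m v >].
  by apply: contrapT => H2; apply: nv => k; apply: contrapT => H3; apply: H2; exists k; apply/asboolP.
case: (ex_minnP ex) => K /asboolP nK minK.
have kK : (k0 < K)%N by rewrite ltnNge; apply/negP => le; apply: nK; exact: om_le le Hv.
case: K nK minK kK => // K nK minK kK.
have HK : Om K m v.
  apply: contrapT => h; suff : (K < K)%N by rewrite ltnn.
  by apply: minK; apply/asboolP.
have HKv : Om K.+1 (m + 2 ^ K) v by case: (om_split HK).
have step i : Om K.+1 (i + m + 2 ^ K) (iter i F v).
  by rewrite -addnA; exact: om_iter.
(* The orbit is below p, F^i v is above p, in the upper one of the two halves there;
   [contains'] is the mirror image. *)
have contains i (d J : nat) p e : d = (i + m)%N -> 0 < e -> Om K.+2 J (iter i F v) ->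
    (exists2 o, Om K.+1 d o & `|x d - o| < e) ->
    (forall w, Om K.+1 d w -> w <= p - e) -> (forall w, Om K.+1 (d + 2 ^ K) w -> p + e <= w) ->
    ep K.+1 (J + 2 ^ K.+1) < ep K.+1 J -> contains_gap k0 (x d) (iter i F v).
  move=> -> e0 HJ [q Hq xq] L U lt; have E := om_uniq H (om_le (leqnSn _) HJ) (step i).
  have h1 := U _ (om_mod E (om_le (leqnSn _) (ep_om H K.+1 J))).
  have h2 := U _ (om_mod E (om_half (ep_om' H K.+1 J))).
  have h3 := ep_between H HJ (ep_om' H K.+1 J).
  have h4 := L _ Hq.
  by exists K.+1, J; split; [exact: (ltnW kK)|..];
    move: xq lt h3; rewrite /between ltr_norml; lra.
have contains' i (d J : nat) p e : d = (i + m)%N -> 0 < e -> Om K.+2 J (iter i F v) ->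
    (exists2 o, Om K.+1 d o & `|x d - o| < e) ->
    (forall w, Om K.+1 (d + 2 ^ K) w -> w <= p - e) -> (forall w, Om K.+1 d w -> p + e <= w) ->
    ep K.+1 J < ep K.+1 (J + 2 ^ K.+1) -> contains_gap k0 (x d) (iter i F v).
  move=> -> e0 HJ [q Hq xq] L U lt; have E := om_uniq H (om_le (leqnSn _) HJ) (step i).
  have h1 := L _ (om_mod E (om_le (leqnSn _) (ep_om H K.+1 J))).
  have h2 := L _ (om_mod E (om_half (ep_om' H K.+1 J))).
  have h3 := ep_between H HJ (ep_om' H K.+1 J).
  have h4 := U _ Hq.
  by exists K.+1, J; split; [exact: (ltnW kK)|..];
    move: xq lt h3; rewrite /between ltr_norml; lra.
have [J0 HJ0] := om_index H K.+2 (om_root Hv).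
have twice i J : Om K.+2 J (iter i F v) ->
    Om K.+2 (J + 2 ^ K.+1) (iter (2 ^ K.+1 + i) F v).
  by move=> HJ; rewrite iterD addnC; exact: om_iter.
have flip J : ep K.+1 (J + 2 ^ K.+1 + 2 ^ K.+1) = ep K.+1 J by exact: ep_double.
case: (om_sep H K (n0.+1 + m)) => -[p [e [e0 L U]]].
  have [N HN] := om_near_all H K.+1 e0.
  pose i := (n0.+1 + N * 2 ^ K.+1)%N.
  have Ni : (N <= i)%N by rewrite (leq_trans _ (leq_addl _ _))// leq_pmulr// expn_gt0.
  have Ei : (i + m = n0.+1 + m %[mod 2 ^ K.+1])%N by rewrite /i addnAC addnC modnMDl.
  have Ei' : (2 ^ K.+1 + i + m = n0.+1 + m %[mod 2 ^ K.+1])%N by rewrite -addnA modnDl.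
  have HJ := om_iter H i HJ0; set J := (i + J0)%N in HJ.
  have tr (d : nat) w : (d = n0.+1 + m %[mod 2 ^ K.+1])%N -> Om K.+1 d w -> w <= p - e.
    by move=> E Hw; apply: L; exact: om_mod E Hw.
  have tr' (d : nat) w : (d = n0.+1 + m %[mod 2 ^ K.+1])%N -> Om K.+1 (d + 2 ^ K) w -> p + e <= w.
    by move=> E Hw; apply: U; apply: om_mod Hw; rewrite -modnDml E modnDml.
  have [lt|le] := ltP (ep K.+1 (J + 2 ^ K.+1)) (ep K.+1 J).
    exists i; first by rewrite /i ltn_addr.
    apply: (contains i _ J p e erefl) => //;
      [apply: HN; natlia|by move=> w; apply: (tr _ _ Ei)|by move=> w; apply: (tr' _ _ Ei)].
  exists (2 ^ K.+1 + i)%N; first by rewrite /i; natlia.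
  apply: (contains _ _ _ p e erefl e0 (twice _ _ HJ)); 
    [apply: HN; natlia|by move=> w; apply: (tr _ _ Ei')|by move=> w; apply: (tr' _ _ Ei')|].
  by rewrite flip lt_neqAle (ep_neq H K.+1 J).
have [N HN] := om_near_all H K.+1 e0.
pose i := (n0.+1 + N * 2 ^ K.+1)%N.
have Ni : (N <= i)%N by rewrite (leq_trans _ (leq_addl _ _))// leq_pmulr// expn_gt0.
have Ei : (i + m = n0.+1 + m %[mod 2 ^ K.+1])%N by rewrite /i addnAC addnC modnMDl.
have Ei' : (2 ^ K.+1 + i + m = n0.+1 + m %[mod 2 ^ K.+1])%N by rewrite -addnA modnDl.
have HJ := om_iter H i HJ0; set J := (i + J0)%N in HJ.
have tr (d : nat) w : (d = n0.+1 + m %[mod 2 ^ K.+1])%N -> Om K.+1 d w -> p + e <= w.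
  by move=> E Hw; apply: U; exact: om_mod E Hw.
have tr' (d : nat) w : (d = n0.+1 + m %[mod 2 ^ K.+1])%N -> Om K.+1 (d + 2 ^ K) w -> w <= p - e.
  by move=> E Hw; apply: L; apply: om_mod Hw; rewrite -modnDml E modnDml.
have [lt|le] := ltP (ep K.+1 J) (ep K.+1 (J + 2 ^ K.+1)).
  exists i; first by rewrite /i ltn_addr.
  apply: (contains' i _ J p e erefl) => //;
      [apply: HN; natlia|by move=> w; apply: (tr' _ _ Ei)|by move=> w; apply: (tr _ _ Ei)].
exists (2 ^ K.+1 + i)%N; first by rewrite /i; natlia.
apply: (contains' _ _ _ p e erefl e0 (twice _ _ HJ)); 
    [apply: HN; natlia|by move=> w; apply: (tr' _ _ Ei')|by move=> w; apply: (tr _ _ Ei')|].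
by rewrite flip lt_neqAle eq_sym (ep_neq H K.+1 J).
Qed.

End Visits.

(** * Excursions *)

Section Tours.
Context {R : realType} (F : R -> R) (z : R).
Implicit Types (w a b c d g p e t u v y : R) (k i j m n : nat) (A B C M : R * R).

Local Notation Om := (omega_class F z).
Local Notation tame := (tame F z).
Local Notation ep := (gap_end F z).
Local Notation same_class := (same_class F z).
Local Notation near_om := (near_om F z).
Local Notation small_gaps := (small_gaps F z).
Local Notation x n := (iter n F z).

Lemma iter_close v L e : continuous F -> 0 < e -> exists2 d, 0 < d &
  forall y i, (i <= L)%N -> `|y - v| < d -> `|iter i F y - iter i F v| < e.
Proof.
move=> Fc e0; elim: L => [|L [d d0 IH]].
  by exists e => // y i; rewrite leqn0 => /eqP ->.
have [d' d'0 Hd'] := @cont_eps _ (iter L.+1 F) v e (@iter_continuous _ _ L.+1 Fc) e0.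
exists (Num.min d d'); first by rewrite lt_min d0.
move=> y i; rewrite leq_eqVlt lt_min => /orP[/eqP ->|iL] /andP[yd yd'].
  exact: Hd' yd'.
exact: IH.
Qed.

Definition approached k n := forall d, 0 < d -> forall N, exists m,
  [/\ (N <= m)%N, `|x m - ep k n| < d & sbetween (ep k n) (ep k (n + 2 ^ k)) (x m)].

(** Start with the segment from an orbit point x m to v.  For a suitable large m its
    images stay short up to time r and up to any time at which F^i v has a far
    companion; after that they are controlled by [segment_near_om] up to the
    first time at which they contain a gap of level at least k0, which exists by
    [segment_contains_gap]. *)
Lemma excursion (H : tame) e k0 k n r : small_gaps e k0 -> 0 < e -> (k0 <= k)%N ->
  approached k n -> exists k' n', (k0 <= k')%N /\
  forall B, inside B (ep k' n') (ep k' (n' + 2 ^ k')) ->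
  exists A M m1 m2, [/\ inside A (ep k n) (ep k (n + 2 ^ k)),
    reach F (near_om e) m1 A M, reach F (near_om e) m2.+1 M B &
    forall t, inI M t -> `|t - iter r F (ep k n)| < e].
Proof.
move=> sm e0 kk app; have [Fc _ _ _] := H; set v := ep k n.
have Hv : Om 0 0 v by exact: (om_root (ep_om H k n)).
have [I0 mates] := far_mates_bounded H Hv e0.
have [d1 d10 Hd1] := iter_close v (I0 + r) Fc e0.
have [d2 [N2 [d20 Hd2]]] := om_times H k0 Hv.
have [N3 HN3] := om_near_all H k0 e0.
have dd : 0 < Num.min d1 d2 by rewrite lt_min d10.
(* A time of the class of v at every level is unique, so it can be avoided. *)
have [m [Nm xm inm nall]] : exists m, [/\ (N2 + N3 <= m)%N, `|x m - v| < Num.min d1 d2,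
    sbetween v (ep k (n + 2 ^ k)) (x m) & ~ (forall k, Om k m v)].
  have [m1 [Nm1 xm1 in1]] := app _ dd (N2 + N3)%N.
  have [all1|nall] := pselect (forall k, Om k m1 v); last by exists m1.
  have [m2 [Nm2 xm2 in2]] := app _ dd (N2 + N3 + m1.+1)%N.
  have [all2|nall] := pselect (forall k, Om k m2 v); last by exists m2; split=> //; natlia.
  have E : m1 = m2 by apply: modn_all_eq => l; exact: (om_uniq H (all1 l) (all2 l)).
  by move: Nm2; rewrite E; natlia.
move: xm; rewrite lt_min => /andP[xm1 xm2].
have Hkv : Om k0 m v by apply: Hd2 => //; natlia.
have [i0 ri0 ci0] := segment_contains_gap H r Hkv nall.
have ex : exists i, (r < i)%N && `[< contains_gap F z k0 (x (i + m)) (iter i F v) >].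
  by exists i0; rewrite ri0; apply/asboolP.
case: (ex_minnP ex) => I /andP[rI /asboolP cI] minI.
case: I rI cI minI => // I rI [k' [n' [kk' g1 g2]]] minI.
have tiny i t : (i <= I0 + r)%N -> between (x (i + m)) (iter i F v) t -> `|t - iter i F v| < e.
  move=> iL; have := Hd1 (x m) i iL xm1; rewrite -iterD /between !ltr_norml; lra.
have seg i t : (i <= I)%N -> between (x (i + m)) (iter i F v) t -> near_om e t.
  move=> iI tb; have [iL|Li] := leqP i (I0 + r).
    exists (iter i F v); first exact: (om_root (om_iter H i Hv)).
    exact: tiny.
  have [q Hq xq] := HN3 (i + m)%N ltac:(natlia).
  apply: (segment_near_om H sm e0 Hq (om_iter H i Hkv) xq _ _ tb).
    by move=> g; apply: mates; natlia.
  move=> cg; suff : (I.+1 <= i)%N by rewrite ltnNge iI.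
  by apply: minI; apply/andP; split; [natlia|apply/asboolP].
exists k', n'; split=> // B Bi.
have rI' : (r <= I)%N by [].
have [A1 A1i A1B] : exists2 A1, inside A1 (x (I + m)) (iter I F v) & cov F A1 B.
  apply: cov_pull => // t /Bi.
  by move: g1 g2; rewrite /between /sbetween /= ; lra.
have A1r : reach F (near_om e) 1 A1 B.
  split; first by move=> t /A1i sb; apply: (seg I) => //; move: sb; rewrite /sbetween /between; lra.
  exists B => //; split=> // t /Bi sb; apply: (small_gap_in H sm kk' (n := n')).
  by move: sb; rewrite /sbetween /between; lra.
have [M Mi MA1] : exists2 M, inside M (x (r + m)) (iter r F v) &
    reach F (near_om e) (I - r) M A1.
  apply: reach_pull => //; first by rewrite -!iterD addnA subnK.
  move=> i t iI; rewrite -!iterD addnA => tb; apply: (seg (i + r)%N) => //; natlia.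
have [A Ai AM] : exists2 A, inside A (x m) v & reach F (near_om e) r A M.
  apply: reach_pull => //; first by rewrite -iterD.
  by move=> i t ir; rewrite -iterD => tb; apply: (seg i) => //; exact: leq_trans rI'.
exists A, M, r, (I - r)%N; split=> //.
- by move=> t /Ai; move: inm; rewrite /sbetween -/v; lra.
- by rewrite -addn1; exact: (reach_trans MA1).
- move=> t /Mi sb; apply: tiny; first exact: leq_addl.
  by move: sb; rewrite /sbetween /between; lra.
Qed.

Lemma natSinv_lt e : 0 < e -> exists N, forall j, (N <= j)%N -> (j.+1%:R : R)^-1 < e.
Proof.
move=> e0; have [N HN] := ltr_add_invr e0; exists N => j Nj.
rewrite add0r in HN; apply: le_lt_trans HN.
by rewrite lef_pV2 ?posrE ?ltr0n// ler_nat ltnS.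
Qed.

Lemma om_pre (H : tame) w : Om 0 0 w -> exists2 v, Om 0 0 v & F v = w.
Proof.
move=> Hw; have [Fc _ _ bnd] := H.
have ex j : exists m, (j.+1 <= m)%N /\ `|x m - w| < (j.+1%:R)^-1.
  by have [|m [jm _ xm]] := Hw (j.+1%:R)^-1 _ j.+1; [rewrite invr_gt0 ltr0n|exists m].
have [s Hs] := choice ex.
have [l _ Hl] := @bounded_cluster _ (fun j => x (s j).-1) 0 1 (fun j => bnd _).
exists l.
  move=> e e0 N; have [j Nj xj] := Hl e e0 N; exists (s j).-1; split=> //.
  - by have [h _] := Hs j; natlia.
  - by rewrite expn0 !modn1.
apply/eqP; rewrite -subr_eq0 -normr_eq0 eq_le normr_ge0 andbT.
apply/ler_addgt0Pl => e e0; rewrite addr0.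
have [d d0 Hd] := @cont_eps _ F l (e / 2) Fc ltac:(lra).
have [N HN] := @natSinv_lt (e / 2) ltac:(lra).
have [j Nj /Hd] := Hl d d0 N; have [h1 h2] := Hs j.
have {h2} := lt_trans h2 (HN j Nj).
have -> : F (x (s j).-1) = x (s j) by rewrite -iterS prednK //; natlia.
by rewrite ler_norml !ltr_norml; lra.
Qed.

Lemma om_pre_iter (H : tame) n w : Om 0 0 w -> exists2 v, Om 0 0 v & iter n F v = w.
Proof.
elim: n w => [|n IH] w Hw; first by exists w.
have [v Hv vw] := om_pre H Hw; have [u Hu uv] := IH v Hv.
by exists u => //=; rewrite uv.
Qed.

(** The classes of v at all levels contain ends of gaps that stay away from v; let
    these accumulate. *)
Lemma isolated_mate (H : tame) k2 e v : Om 0 0 v -> 0 < e ->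
  (forall k n, (k2 <= k)%N -> e <= `|ep k n - v|) ->
  exists2 v', same_class v v' & v != v'.
Proof.
move=> Hv e0 far; have [_ _ _ bnd] := H.
have [c Hc] := choice (fun k => om_index H k Hv).
have [l _ Hl] := @bounded_cluster _ (fun k => ep k (c k)) 0 1
  (fun k => om_bnd H (ep_om H k (c k))).
have Hlk k i : Om k i v -> Om k i l.
  move=> Hi; apply: om_closed => e' e'0; have [j kj xj] := Hl e' e'0 k.
  exists (ep j (c j)) => //.
  have E := om_uniq H (om_le kj (Hc j)) Hi.
  by apply: (om_mod E); apply: (om_le kj); apply: (om_le (leqnSn j)); exact: ep_om.
exists l => //; apply/eqP => vl.
by have [j kj] := Hl e e0 k2; rewrite -vl; have := far j (c j) kj; lra.
Qed.

(** If gaps do not accumulate at w, they do not accumulate at its backward images v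
    either, so that v has a companion v' by [isolated_mate].  Of three backward
    images one, v, is not extremal in its class of level k0.  So there are points
    of that class on the side of v that is opposite to v', but not at every
    level; at the level where they disappear, v is the end of a gap.  The orbit
    approaches v from inside the gap because it hardly ever comes between v and
    v'. *)
Lemma visit_dichotomy (H : tame) e k0 w : Om 0 0 w -> 0 < e ->
  (exists k n, (k0 <= k)%N /\ `|ep k n - w| < e) \/
  (exists k n r, [/\ (k0 <= k)%N, iter r F (ep k n) = w & approached k n]).
Proof.
move=> Hw e0; have [near|far] := pselect (exists k n, (k0 <= k)%N /\ `|ep k n - w| < e).
  by left.
right; have {}far k n : (k0 <= k)%N -> e <= `|ep k n - w|.
  by move=> kk; rewrite leNgt; apply/negP => lt; apply: far; exists k, n.
have [Fc _ _ _] := H.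
have [i0 Hi0] := om_index H k0 Hw.
have [Mx HMx leMx] := om_max H k0 i0; have [mn Hmn lemn] := om_min H k0 i0.
have pre l : exists v, [/\ Om k0 i0 v, Om 0 0 v & iter (l * 2 ^ k0) F v = w].
  have [v Hv vw] := om_pre_iter H (l * 2 ^ k0) Hw; exists v; split=> //.
  have [i Hi] := om_index H k0 Hv; apply: (om_mod _ Hi).
  have := om_iter H (l * 2 ^ k0) Hi; rewrite vw => /(om_uniq H Hi0) ->.
  by rewrite modnMDl.
(* Backward images at different times differ, as w is not periodic. *)
have distinct l l' v : (l < l')%N -> iter (l * 2 ^ k0) F v = w ->
    iter (l' * 2 ^ k0) F v = w -> False.
  move=> ll' h1 h2; have lle : (l * 2 ^ k0 <= l' * 2 ^ k0)%N by rewrite leq_mul2r (ltnW ll') orbT.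
  have := @om_not_periodic _ _ _ H w (l' * 2 ^ k0 - l * 2 ^ k0) Hw.
  rewrite -{1}h1 -iterD subnK // => /(_ h2)/eqP; rewrite subn_eq0 leq_mul2r.
  by rewrite expn_eq0 /= leqNgt ll'.
have [v [r [Hv0 Hv vw ltv]]] : exists v r, [/\ Om k0 i0 v, Om 0 0 v, iter r F v = w & mn < v < Mx].
  have [v0 [a0 b0 c0]] := pre 0%N; have [v1 [a1 b1 c1]] := pre 1%N.
  have [v2 [a2 b2 c2]] := pre 2%N.
  have n01 : v0 != v1 by apply/eqP => E; apply: (@distinct 0 1 v0)%N => //; rewrite E.
  have n02 : v0 != v2 by apply/eqP => E; apply: (@distinct 0 2 v0)%N => //; rewrite E.
  have n12 : v1 != v2 by apply/eqP => E; apply: (@distinct 1 2 v1)%N => //; rewrite E.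
  have := leMx _ a0; have := leMx _ a1; have := leMx _ a2.
  have := lemn _ a0; have := lemn _ a1; have := lemn _ a2.
  move=> l2 l1 l0 u2 u1 u0.
  have [h|h] := boolP (mn < v0 < Mx); first by exists v0, (0 * 2 ^ k0)%N.
  have [h1|h1] := boolP (mn < v1 < Mx); first by exists v1, (1 * 2 ^ k0)%N.
  exists v2, (2 * 2 ^ k0)%N; split=> //.
  by move: n01 n02 n12 h h1; rewrite !neq_lt; lra.
(* The images under F^r of a gap near v would have a gap between them near w. *)
have [k2 [e2 [kk2 e20 farv]]] : exists k2 e2, [/\ (k0 <= k2)%N, 0 < e2 &
    forall k n, (k2 <= k)%N -> e2 <= `|ep k n - v|].
  have [d d0 Hd] := iter_close v r Fc e0.
  have [k1 Hk1] := gap_small H (e := d / 2) ltac:(lra).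
  exists (k0 + k1)%N, (d / 2); split=> //; [exact: leq_addr|lra|].
  move=> k n kk; rewrite leNgt; apply/negP => lt.
  have sm := Hk1 k n ltac:(natlia).
  have h1 : `|iter r F (ep k n) - w| < e by rewrite -vw; apply: Hd => //; lra.
  have h2 : `|iter r F (ep k (n + 2 ^ k)) - w| < e.
    by rewrite -vw; apply: Hd => //; move: lt sm; rewrite !ltr_norml; lra.
  have H1 := om_iter H r (ep_om H k n); have H2 := om_iter H r (ep_om' H k n).
  rewrite addnA in H2; have := ep_between H H1 H2; have := far k (r + n)%N ltac:(natlia).
  move: h1 h2; rewrite /between !ltr_norml => h1 h2 h3 h4.
  by move: h3; apply/negP; rewrite -ltNge ltr_norml; lra.
have [v' vv' nvv'] := isolated_mate H Hv e20 farv.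
have Hv' := same_om Hv vv'.
pose side y := sbetween y v' v.
pose Pk k := exists i y, [/\ Om k i v, Om k i y & side y].
have Pk0 : Pk k0.
  have [lt|le] := ltP v v'.
    by exists i0, mn; split=> //; rewrite /side /sbetween; lra.
  have lt : v' < v by rewrite lt_neqAle eq_sym nvv'.
  by exists i0, Mx; split=> //; rewrite /side /sbetween; lra.
(* Otherwise v would lie in the hull of a class, between y and v'. *)
have noside y : Om 0 0 y -> same_class v y -> ~ side y.
  move=> Hy vy sy; have yv := same_sym H Hv vy.
  have yv' : same_class y v' by move=> k i /yv /vv'.
  by have := class_hull_empty H Hy yv' Hv; rewrite -/(side y) sy.
have ex : exists k, (k0 <= k)%N && `[< ~ Pk k >].
  apply: contrapT => H1.
  have all k : exists y, (k0 <= k)%N -> side y /\ exists i, Om k i v /\ Om k i y.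
    have [kk|kk] := leqP k0 k; last by exists 0.
    have [Pkk|nP] := pselect (Pk k); first by have [i [y [h1 h2 h3]]] := Pkk; exists y; split=> //; exists i.
    by exfalso; apply: H1; exists k; rewrite kk; apply/asboolP.
  have [y Hy] := choice all.
  pose y' k := y (k0 + k)%N.
  have Hy' k : side (y' k) /\ exists i, Om (k0 + k) i v /\ Om (k0 + k) i (y' k).
    by apply: Hy; exact: leq_addr.
  have by' k : 0 <= y' k <= 1 by have [_ [i [_ h]]] := Hy' k; exact: (om_bnd H h).
  have [l _ Hl] := bounded_cluster by'.
  have vl : same_class v l.
    move=> k i Hi; apply: om_closed => e' e'0; have [j kj xj] := Hl e' e'0 k.
    exists (y' j) => //; have [_ [i' [h1 h2]]] := Hy' j.
    have kj' : (k <= k0 + j)%N by natlia.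
    by apply: (om_mod (om_uniq H (om_le kj' h1) Hi)); exact: (om_le kj' h2).
  have Hlo := same_om Hv vl.
  have lv : l = v.
    apply/eqP/negP => /negP nlv; apply: (noside l Hlo vl).
    have [j _ xj] := Hl `|l - v| ltac:(by rewrite normr_gt0 subr_eq0) 0%N.
    have [sj _] := Hy' j; move: sj xj nlv; rewrite /side /sbetween neq_lt => sj xj nlv.
    by move: xj; case/orP: nlv => nlv; [rewrite (@ltr0_norm _ (l - v))|rewrite (@gtr0_norm _ (l - v))]; rewrite ?ltr_norml; lra.
  have [j kj] := Hl e2 e20 k2; rewrite lv => xj.
  have [sj [i [h1 h2]]] := Hy' j.
  have [s|ns] := pselect (same_class v (y' j)); first exact: (noside _ (om_root h2) s sj).
  have [k [n [kk _ _ b1 _]]] := gap_between H h1 h2 ns.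
  have := farv k n ltac:(natlia); move: xj b1; rewrite /between => xj b1.
  by apply/negP; rewrite -ltNge; move: xj; rewrite !ltr_norml; lra.
case: (ex_minnP ex) => k1 /andP[kk1 /asboolP nPk1] mink1.
have lt01 : (k0 < k1)%N.
  by rewrite ltn_neqAle kk1 andbT; apply/eqP => E; apply: nPk1; rewrite -E.
case: k1 lt01 nPk1 mink1 kk1 => // k1 lt01 nPk1 mink1 _.
have [i [y [Hiv Hiy sy]]] : Pk k1.
  apply: contrapT => h; suff : (k1 < k1)%N by rewrite ltnn.
  by apply: mink1; rewrite -ltnS lt01; apply/asboolP.
(* At level k1 the points v and y are in different halves. *)
have [n [Hn Hny]] : exists n, Om k1.+1 n v /\ Om k1.+1 (n + 2 ^ k1) y.
  case: (om_split Hiv) => h1; case: (om_split Hiy) => h2.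
  - by exfalso; apply: nPk1; exists i, y.
  - by exists i.
  - exists (i + 2 ^ k1)%N; split=> //; apply: om_mod h2.
    by rewrite addn_two_halves modnDr.
  - by exfalso; apply: nPk1; exists (i + 2 ^ k1)%N, y.
have vE : ep k1 n = v.
  apply/eqP/negP => /negP ne; apply: nPk1; exists n, (ep k1 n); split=> //; first exact: ep_om.
  have := ep_between H Hn Hny; move: ne sy; rewrite /side /sbetween /between neq_lt; lra.
have nE := ep_neq H k1 n; rewrite vE in nE.
have bE := ep_between' H Hn Hny.
exists k1, n, r; split; rewrite ?vE //.
move=> d d0 N; rewrite vE; apply: contrapT => nox.
pose o' := ep k1 (n + 2 ^ k1).
pose d' := Num.min d (Num.min `|o' - v| `|v' - v|).
have d'0 : 0 < d' by rewrite !lt_min d0 !normr_gt0 !subr_eq0 eq_sym nE eq_sym.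
(* Near v the orbit is at v, in the gap, or between v and v'; each of the first
   and the last of these happens at most once. *)
have inner m : (N <= m)%N -> `|x m - v| < d' -> x m = v \/ sbetween v v' (x m).
  move=> Nm; rewrite !lt_min => /and3P[xd xo xv].
  have [->|ne] := eqVneq (x m) v; first by left.
  right; have ns : ~~ sbetween v o' (x m).
    by apply/negP => sb; apply: nox; exists m.
  move: xo xv ns ne nE nvv' bE sy; rewrite -/o' /side /sbetween /between !neq_lt.
  move=> xo xv ns ne nE nvv' bE sy.
  have [lt|ge] := ltP v v'.
    by move: xo xv; rewrite (@gtr0_norm _ (v' - v)) ?(@ltr0_norm _ (o' - v)) ?ltr_norml; lra.
  by move: xo xv; rewrite (@ltr0_norm _ (v' - v)) ?(@gtr0_norm _ (o' - v)) ?ltr_norml; lra.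
have [m1 [N1 _ x1]] := Hv d' d'0 N.
have [m2 [N2 _ x2]] := Hv d' d'0 m1.+1.
have [m3 [N3 _ x3]] := Hv d' d'0 m2.+1.
have once m m' : (m < m')%N -> x m = v -> x m' = v -> False.
  move=> mm' h1 h2; have := @om_not_periodic _ _ _ H v (m' - m) Hv.
  rewrite -{1}h1 -iterD subnK ?(ltnW mm') // => /(_ h2)/eqP.
  by rewrite subn_eq0 leqNgt mm'.
have once' m m' : (m < m')%N -> sbetween v v' (x m) -> sbetween v v' (x m') -> False.
  by move=> mm' h1 h2; have E := visit_once H Hv vv' h1 h2; rewrite E ltnn in mm'.
have l12 : (m1 < m2)%N by []. have l23 : (m2 < m3)%N by [].
have l13 := ltn_trans l12 l23.
have Nm2 : (N <= m2)%N by natlia. have Nm3 : (N <= m3)%N by natlia.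
case: (inner _ N1 x1) => a1; case: (inner _ Nm2 x2) => a2; case: (inner _ Nm3 x3) => a3.
all: first [exact: once l12 a1 a2|exact: once l23 a2 a3|exact: once l13 a1 a3|
  exact: once' l12 a1 a2|exact: once' l23 a2 a3|exact: once' l13 a1 a3].
Qed.

End Tours.

(** * Itineraries of the nonautonomous system *)

Section Itinerary.
Context {R : realType} (F : R -> R) (z : R).
Implicit Types (w a b c d e p t u v y : R) (k i j l m n : nat) (A B C M : R * R).

Local Notation Om := (omega_class F z).
Local Notation tame := (tame F z).
Local Notation ep := (gap_end F z).
Local Notation near_om := (near_om F z).
Local Notation small_gaps := (small_gaps F z).
Local Notation gapset := (gapset F z).
Local Notation hub k := (hub F z (gapset k) k).

Lemma hub_goto (H : tame) k n n' C B m0 : hub k n C m0 ->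
  inside B (ep k n') (ep k (n' + 2 ^ k)) -> exists m, reach F (gapset k) m C B.
Proof.
move=> [_ HC] Bi; pose m := (n' + n * (2 ^ k.+1).-1 + m0 * 2 ^ k.+1)%N; exists m.
have T0 : (0 < 2 ^ k.+1)%N by rewrite expn_gt0.
have E : (n + m = n' %[mod 2 ^ k.+1])%N.
  have -> : (n + m = (n + m0) * 2 ^ k.+1 + n')%N.
    by rewrite /m; case: (2 ^ k.+1)%N T0 => // T _ /=; rewrite !mulnS; ring.
  by rewrite modnMDl.
apply: HC; first by rewrite /m (leq_trans _ (leq_addl _ _))// leq_pmulr.
rewrite (ep_mod H E) [ep k (_ + _ + _)](ep_mod H (n := (n' + 2 ^ k)%N)) //.
by rewrite -modnDml E modnDml.
Qed.

Lemma gapset_near (H : tame) e k0 k t : small_gaps e k0 -> (k0 <= k)%N -> gapset k t -> near_om e t.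
Proof. by move=> sm kk [n]; exact: (small_gap_in H sm kk). Qed.

Lemma hub_near (H : tame) e k0 k n C m0 : small_gaps e k0 -> (k0 <= k)%N -> hub k n C m0 ->
  forall t, inI C t -> near_om e t.
Proof.
move=> sm kk [Ci _] t /Ci sb; apply: (small_gap_in H sm kk (n := n)).
by move: sb; rewrite /sbetween /between; lra.
Qed.

Lemma hub_climb (H : tame) e k0 k n C m0 l : small_gaps e k0 -> (k0 <= k)%N -> hub k n C m0 ->
  exists n' C' m0' m, hub (l + k)%N n' C' m0' /\ reach F (near_om e) m C C'.
Proof.
move=> sm kk hC; elim: l => [|l [n1 [C1 [m1 [m [hC1 r1]]]]]].
  by exists n, C, m0, 0%N; split=> //; split=> //; exact: (hub_near H sm kk hC).
have kl : (k0 <= l + k)%N by exact: leq_trans (leq_addl _ _).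
have [n2 [C2 [m2 [m' [hC2 r2]]]]] := hub_up H (small_gap_in H sm kl)
  (small_gap_in H sm (leqW kl)) hC1.
by exists n2, C2, m2, (m + m'.+1)%N; split; [exact: hC2|exact: (reach_trans r1 r2)].
Qed.

(** Near a gap the loops pass by themselves; otherwise the visit is an excursion.
    In both cases the climb to level K comes last. *)
Lemma hub_visit (H : tame) e k0 k n C m0 K w : small_gaps e k0 -> 0 < e -> (k0 <= k)%N ->
  hub k n C m0 -> Om 0 0 w -> exists k' n' C' m0' M m1 m2,
  [/\ (K <= k')%N /\ hub k' n' C' m0', reach F (near_om e) m1 C M,
    reach F (near_om e) m2 M C' & forall t, inI M t -> `|t - w| < 2 * e].
Proof.
move=> sm e0 kk hC Hw.
have gn k1 t : (k0 <= k1)%N -> gapset k1 t -> near_om e t by exact: gapset_near.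
case: (visit_dichotomy H k Hw e0) => [[k1 [n1 [kk1 near]]]|[k1 [n1 [r [kk1 vw app]]]]].
  have k01 := leq_trans kk kk1.
  have [n2 [C2 [m2 [m [hC2 r2]]]]] := hub_climb H (k1 - k) sm kk hC.
  rewrite subnK // in hC2.
  have [M [mM hM]] := hub_ex H n1 (gap_in_gapset (F := F) (z := z) (k := k1)).
  have [l rM] := hub_goto H hC2 hM.1.
  have [n3 [C3 [m3 [m' [hC3 r3]]]]] := hub_climb H K sm k01 hM.
  exists (K + k1)%N, n3, C3, m3, M, (m + l)%N, m'; split=> //.
  - by split=> //; exact: leq_addr.
  - by apply: (reach_trans r2); apply: reach_sub rM => t; exact: gn.
  - move=> t /(hM.1) sb; have := sm k1 n1 k01; move: sb near.
    by rewrite /sbetween !ltr_norml; lra.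
have k01 := leq_trans kk kk1.
have [k2 [n2 [kk2 Hexc]]] := excursion H r sm e0 k01 app.
have [C2 [m2 hC2]] := hub_ex H n2 (gap_in_gapset (F := F) (z := z) (k := k2)).
have [A [M [l1 [l2 [Ai AM MC nM]]]]] := Hexc C2 hC2.1.
have [n3 [C3 [m3 [m [hC3 r3]]]]] := hub_climb H (k1 - k) sm kk hC.
rewrite subnK // in hC3.
have [l rA] := hub_goto H hC3 Ai.
have [n4 [C4 [m4 [m' [hC4 r4]]]]] := hub_climb H K sm kk2 hC2.
exists (K + k2)%N, n4, C4, m4, M, (m + (l + l1))%N, (l2.+1 + m')%N; split=> //.
- by split=> //; exact: leq_addr.
- apply: (reach_trans r3); apply: (reach_trans _ AM).
  by apply: reach_sub rA => t; exact: gn.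
- exact: (reach_trans MC r4).
- by move=> t /nM; rewrite vw; lra.
Qed.

Variable g : nat -> R -> R.

Definition perturbation := (forall n, continuous (g n.+1)) /\
  forall e, 0 < e -> exists N, forall n, (N <= n)%N -> forall y, `|g n y - F y| < e.

(** Unlike [cov], this asks for no room: it concerns the perturbed maps, which are
    not perturbed any further. *)
Definition covers h A B := forall y, inI B y -> exists2 x, inI A x & h x = y.

Fixpoint track (Q : R -> Prop) T m A B : Prop :=
  if m is m'.+1 then (forall t, inI A t -> Q t) /\
    exists2 C, covers (g T.+1) A C & track Q T.+1 m' C B
  else A = B /\ forall t, inI A t -> Q t.

Lemma track_cat Q T m n A B C : track Q T m A B -> track Q (T + m) n B C ->
  track Q T (m + n) A C.
Proof.
elim: m T A => [|m IH] T A /=; first by case=> ->; rewrite addn0.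
by move=> [QA [D AD DB]] BC; split=> //; exists D => //; apply: IH DB _; rewrite addSnnS.
Qed.

Lemma cov_covers A B : perturbation -> cov F A B -> exists N, forall T, (N <= T)%N -> covers (g T.+1) A B.
Proof.
move=> [gc un] [p [q [Ap Aq pq]]].
pose lo := Num.min B.1 B.2; pose hi := Num.max B.1 B.2.
have lo1 : F p < lo.
  by rewrite lt_min; have := pq _ (inI_l B); have := pq _ (inI_r B); lra.
have hi1 : hi < F q.
  by rewrite gt_max; have := pq _ (inI_l B); have := pq _ (inI_r B); lra.
have e0 : 0 < Num.min (lo - F p) (F q - hi) by rewrite lt_min; apply/andP; split; lra.
have [N HN] := un _ e0; exists N => T NT y By.
have := HN T.+1 (leqW NT) p; have := HN T.+1 (leqW NT) q; rewrite !lt_min !ltr_norml => h1 h2.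
have loy : lo <= y <= hi.
  by move: By; rewrite /inI /between /lo /hi ge_min le_max => /orP[] /andP[-> ->]; rewrite ?orbT.
have [s sb <-] : exists2 s, between p q s & g T.+1 s = y.
  by apply: IVT_between => //; rewrite /between; lra.
by exists s => //; move: Ap Aq sb; rewrite /inI /between; lra.
Qed.

Lemma reach_track Q m A B : perturbation -> reach F Q m A B ->
  exists N, forall T, (N <= T)%N -> track Q T m A B.
Proof.
move=> pert; elim: m A => [|m IH] A; first by exists 0%N.
move=> [QA [C AC /IH[N HN]]]; have [N' HN'] := cov_covers pert AC.
exists (N + N')%N => T NT; split=> //; exists C; [apply: HN'|apply: HN]; natlia.
Qed.

Lemma loop_wait Q m C : perturbation -> reach F Q m.+1 C C ->
  exists N, forall T, (N <= T)%N -> forall T', exists d : nat, (T' <= T + d)%N /\ track Q T d C C.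
Proof.
move=> pert r; have [N HN] := reach_track pert r; exists N => T NT; elim=> [|T' [d [Td tr]]].
  by exists 0%N; split=> //; split=> // t Ct; case: r => QC _; exact: QC.
exists (d + m.+1)%N; split; first by natlia.
by apply: (track_cat tr); apply: HN; natlia.
Qed.

Lemma track_path Q T m A B : track Q T m A B -> exists I : nat -> R * R,
  [/\ I T = A, I (T + m)%N = B,
    forall j, (T <= j < T + m)%N -> covers (g j.+1) (I j) (I j.+1) &
    forall j, (T <= j <= T + m)%N -> forall t, inI (I j) t -> Q t].
Proof.
elim: m T A => [|m IH] T A /=.
  move=> [<- QA]; exists (fun=> A); split=> // j /andP[h1 h2].
  exfalso; natlia.
move=> [QA [C AC /IH[I [I0 I1 Ic IQ]]]].
exists (fun j => if (j <= T)%N then A else I j); split.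
- by rewrite leqnn.
- by rewrite leqNgt addnS ltnS leq_addr /= -addSn.
- move=> j /andP[jT1 jT2]; have [jT'|jT'] := leqP j T.
    have -> : j = T by natlia.
    by rewrite ltnn I0.
  rewrite leqNgt (leqW jT') /=; apply: Ic; natlia.
- move=> j /andP[jT1 jT2]; have [jT'|jT'] := leqP j T => //.
  by apply: IQ; natlia.
Qed.

Lemma track_path2 Q T m n A M B : track Q T m A M -> track Q (T + m) n M B ->
  exists I : nat -> R * R,
  [/\ I T = A, I (T + (m + n))%N = B,
    forall j, (T <= j < T + (m + n))%N -> covers (g j.+1) (I j) (I j.+1),
    forall j, (T <= j <= T + (m + n))%N -> forall t, inI (I j) t -> Q t &
    I (T + m)%N = M].
Proof.
move=> /track_path[I [I0 I1 Ic IQ]] /track_path[J [J0 J1 Jc JQ]].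
exists (fun j => if (j <= T + m)%N then I j else J j); split.
- by rewrite leq_addr.
- rewrite addnA; case: leqP => // h; have n0 : n = 0%N by natlia.
  by move: J1; rewrite n0 !addn0 J0 I1.
- move=> j /andP[jT1 jT2]; have [jT'|jT'] := leqP j (T + m).
    have [jm|jm] := leqP j.+1 (T + m); first by apply: Ic; natlia.
    have E : j = (T + m)%N by natlia.
    rewrite E I1 -J0; apply: Jc; natlia.
  rewrite leqNgt (leqW jT') /=; apply: Jc; natlia.
- move=> j /andP[jT1 jT2]; case: leqP => h; [apply: IQ|apply: JQ]; natlia.
- by rewrite leqnn I1.
Qed.

(** The points w s are the targets to be visited: as they follow the orbit, every
    point of omega is a cluster point of them. *)
Lemma omega_shadow (H : tame) : exists w : nat -> R, (forall s, Om 0 0 (w s)) /\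
  forall e, 0 < e -> exists N, forall s, (N <= s)%N -> `|iter s F z - w s| < e.
Proof.
pose D s := [set `|iter s F z - w| | w in [set w | Om 0 0 w]].
have infD s : has_inf (D s).
  have [w0 Hw0] := om_ex H 0 0; split; first by exists `|iter s F z - w0|, w0.
  by exists 0 => _ [w _ <-].
have ex s : exists w, Om 0 0 w /\ `|iter s F z - w| < inf (D s) + s.+1%:R^-1.
  have s0 : (0 : R) < s.+1%:R^-1 by rewrite invr_gt0 ltr0n.
  by have [_ [w Hw <-] lt] := inf_adherent s0 (infD s); exists w.
have [w Hw] := choice ex; exists w; split=> [s|e e0]; first by case: (Hw s).
have e2 : 0 < e / 2 by lra.
have [N HN] := om_near H 0 0 e2; have [N' HN'] := natSinv_lt e2.
exists (N + N')%N => s Ns; have [_ lt] := Hw s; apply: (lt_le_trans lt).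
have [v Hv xv] := HN s ltac:(natlia) ltac:(by rewrite expn0 !modn1).
have h1 : inf (D s) <= `|iter s F z - v| by apply: inf_lbound; [case: (infD s)|exists v].
have h2 := HN' s ltac:(natlia).
by rewrite [leRHS]splitr lerD // ltW //; exact: le_lt_trans h1 xv.
Qed.

(** Stage s starts at a hub whose level is high enough for the precision 1/(s+1).  It
    goes round its loop until the perturbations are small enough for the visit
    of w s and for the loop of the next hub, and then makes that visit. *)
Lemma infinite_path (H : tame) : perturbation -> exists (T0 : nat) (I : nat -> R * R),
  [/\ forall t, inI (I T0) t -> 0 <= t <= 1,
    forall j, (T0 <= j)%N -> covers (g j.+1) (I j) (I j.+1),
    forall e, 0 < e -> exists N, forall j, (N <= j)%N -> forall t, inI (I j) t -> near_om e t &
    forall w e N, Om 0 0 w -> 0 < e -> exists2 j, (N <= j)%N & forall t, inI (I j) t -> `|t - w| < e].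
Proof.
move=> pert; have [w [Hw sh]] := omega_shadow H.
pose ee s : R := s.+1%:R^-1.
have ee0 s : 0 < ee s by rewrite invr_gt0 ltr0n.
have [K HK] := choice (fun s => gap_small H (ee0 s)).
(* A state (s, (T, C)): stage s begins at time T with the hub C. *)
pose St (p : nat * (nat * (R * R))) := exists k n m0, [/\ hub k n p.2.2 m0, (K p.1 <= k)%N &
  forall T', exists d : nat, (T' <= p.2.1 + d)%N /\ track (near_om (ee p.1)) p.2.1 d p.2.2 p.2.2].
have start s k n C m0 : hub k n C m0 -> (K s <= k)%N ->
    exists N, forall T, (N <= T)%N -> St (s, (T, C)).
  move=> hC kk; have [l r] := hub_loop H hC.
  have [N HN] := loop_wait pert (reach_sub (fun t => gapset_near H (HK s) kk) r).
  by exists N => T NT; exists k, n, m0; split=> //=; exact: HN.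
pose Rel (p q : nat * (nat * (R * R))) := [/\ St q, q.1 = p.1.+1, (p.2.1 < q.2.1)%N &
  exists m n M, [/\ q.2.1 = (p.2.1 + (m + n))%N, track (near_om (ee p.1)) p.2.1 m p.2.2 M,
    track (near_om (ee p.1)) (p.2.1 + m) n M q.2.2 &
    forall t, inI M t -> `|t - w p.1| < 2 * ee p.1]].
have step (p : nat * (nat * (R * R))) : exists q, St p -> Rel p q.
  have [[k [n [m0 [hC kk wait]]]]|nS] := pselect (St p); last by exists p.
  have [k' [n' [C' [m0' [M [m1 [m2 [[kk' hC'] r1 r2 nM]]]]]]]] :=
    hub_visit H (K p.1.+1) (HK p.1) (ee0 p.1) kk hC (Hw p.1).
  have [N3 HN3] := start p.1.+1 _ _ _ _ hC' kk'.
  have [N1 HN1] := reach_track pert r1; have [N2 HN2] := reach_track pert r2.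
  have [d [dT tr]] := wait (N1 + N2 + N3 + p.2.1.+1)%N.
  exists (p.1.+1, ((p.2.1 + (d + m1 + m2))%N, C')) => _; split=> //=.
  - by apply: HN3; natlia.
  - by natlia.
  - exists (d + m1)%N, m2, M; split=> //.
      by apply: (track_cat tr); apply: HN1; natlia.
    by apply: HN2; natlia.
have [nxt Hnxt] := choice step.
have [C0 [m0 hC0]] := hub_ex H 0 (gap_in_gapset (F := F) (z := z) (k := K 0%N)).
have [N0 HN0] := start 0%N _ _ _ _ hC0 (leqnn _).
pose P s := iter s nxt (0%N, (N0, C0)).
have PS s : St (P s).
  elim: s => [|s IH]; first exact: HN0.
  by have [] := Hnxt _ IH.
have PR s : Rel (P s) (P s.+1) by exact: Hnxt.
have P1 s : (P s).1 = s by elim: s => // s IH; have [_ -> _ _] := PR s; rewrite IH.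
pose t s := (P s).2.1; pose C s := (P s).2.2.
have tS s : (t s < t s.+1)%N by have [] := PR s.
have seg s : exists I : nat -> R * R, [/\ I (t s) = C s, I (t s.+1) = C s.+1,
    forall j, (t s <= j < t s.+1)%N -> covers (g j.+1) (I j) (I j.+1),
    forall j, (t s <= j <= t s.+1)%N -> forall u, inI (I j) u -> near_om (ee s) u &
    exists2 j, (t s <= j <= t s.+1)%N & forall u, inI (I j) u -> `|u - w s| < 2 * ee s].
  have [_ _ _ [m [n [M [E r1 r2 nM]]]]] := PR s; rewrite P1 in r1 r2 nM.
  have [I [I0 I1 Ic IQ IM]] := track_path2 r1 r2.
  exists I; rewrite /t E; split=> //.
  by exists ((P s).2.1 + m)%N; [natlia|rewrite IM].
have [J HJ] := choice seg.
have tmono (a b : nat) : (a <= b)%N -> (t a <= t b)%N.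
  elim: b => [|b IH]; first by rewrite leqn0 => /eqP ->.
  rewrite leq_eqVlt => /orP[/eqP -> //|ab]; exact: leq_trans (IH ab) (ltnW (tS b)).
have tge s : (s <= t s)%N by elim: s => // s IH; exact: leq_ltn_trans IH (tS s).
have exs j : exists s, (j < t s.+1)%N by exists j; exact: (leq_trans (tge j.+1)).
pose sg j := ex_minn (exs j).
have sgP j : (j < t (sg j).+1)%N by rewrite /sg; case: ex_minnP.
have sgmin j s : (j < t s.+1)%N -> (sg j <= s)%N by rewrite /sg; case: ex_minnP => l _; apply.
have sgle j : (t 0%N <= j)%N -> (t (sg j) <= j)%N.
  move=> tj; rewrite leqNgt; apply/negP; case E : (sg j) => [|s] lt; first by rewrite ltnNge tj in lt.
  by have := sgmin _ _ lt; rewrite E ltnn.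
have sgE j s : (t s <= j < t s.+1)%N -> sg j = s.
  move=> /andP[h1 h2]; apply/eqP; rewrite eqn_leq sgmin //= leqNgt; apply/negP => lt.
  have := leq_trans (sgP j) (leq_trans (tmono _ _ lt) h1); by rewrite ltnn.
pose I j := J (sg j) j.
have IE j s : (t s <= j <= t s.+1)%N -> I j = J s j.
  move=> /andP[h1]; rewrite leq_eqVlt => /orP[/eqP E|h2]; last by rewrite /I (sgE j s) // h1.
  have [_ J1 _ _ _] := HJ s; have [J2 _ _ _ _] := HJ s.+1.
  by rewrite /I (sgE j s.+1) E ?leqnn ?tS // J1 J2.
exists (t 0%N), I; split.
- move=> u; have [J0 _ _ _ _] := HJ 0%N; rewrite (IE _ 0%N) ?leqnn ?(ltnW (tS 0%N)) // J0.
  move=> /(hC0.1) sb; have b1 := om_bnd H (ep_om H (K 0%N) 0).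
  by have b2 := om_bnd H (ep_om' H (K 0%N) 0); move: sb b1 b2; rewrite /sbetween; lra.
- move=> j tj; have [_ _ Jc _ _] := HJ (sg j).
  have h := sgP j; have h' := sgle _ tj.
  rewrite (IE j.+1 (sg j)); last by rewrite (leqW h') h.
  by apply: Jc; rewrite h' h.
- move=> e e0; have [N HN] := natSinv_lt e0.
  exists (t N) => j tj u; have tj0 : (t 0%N <= j)%N by exact: leq_trans (tmono _ _ (leq0n N)) tj.
  have [_ _ _ JQ _] := HJ (sg j); have h := sgP j; have h' := sgle _ tj0.
  move=> /JQ; rewrite h' (ltnW h) => /(_ isT)[v Hv uv]; exists v => //.
  apply: (lt_trans uv); apply: HN; rewrite leqNgt; apply/negP => lt.
  by have := leq_trans (leq_ltn_trans tj h) (tmono _ _ lt); rewrite ltnn.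
- move=> v e N Hv e0; have e4 : 0 < e / 4 by lra.
  have [N1 HN1] := natSinv_lt e4; have [N2 HN2] := sh _ e4.
  have [s [Ns _ xv]] := Hv _ e4 (N + N1 + N2)%N.
  have [_ _ _ _ [j tj jw]] := HJ s; exists j.
    by apply: leq_trans (leq_trans (tge s) _); [natlia|case/andP: tj].
  move=> u; rewrite (IE j s) // => /jw uw.
  have h1 : ee s < e / 4 by apply: HN1; natlia.
  have h2 := HN2 s ltac:(natlia).
  by move: uw h1 h2 xv; rewrite !ltr_norml; lra.
Qed.

End Itinerary.

(** * The trajectory *)

Section Realization.
Context {R : realType}.
Implicit Types (e l w y : R) (u : nat -> R).

Definition cluster_pt u l := forall e, 0 < e -> forall N, exists2 n, (N <= n)%N & `|u n - l| < e.

Lemma cluster_subseqP u l :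
  (exists s : nat -> nat, {homo s : i j / (i < j)%N} /\ u (s i) @[i --> \oo] --> l) <->
  cluster_pt u l.
Proof.
split=> [[s [sinc /cvgrPdist_lt sl]] e e0 N|cl].
  have [M _ HM] := sl e e0.
  have sge n : (n <= s n)%N by elim: n => // n IH; exact: leq_ltn_trans IH (sinc _ _ (ltnSn n)).
  exists (s (N + M)%N); first exact: leq_trans (leq_addr _ _) (sge _).
  by rewrite distrC; apply: HM; rewrite /= leq_addl.
have ex p : exists n, (p.1 <= n)%N /\ `|u n - l| < (p.2.+1%:R : R)^-1.
  have [|n Nn un] := cl (p.2.+1%:R)^-1 _ p.1; first by rewrite invr_gt0 ltr0n.
  by exists n.
have [pick Hpick] := choice ex.
pose s := fix s n := if n is m.+1 then pick ((s m).+1, m.+1) else pick (0%N, 0%N).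
have sS n : (s n < s n.+1)%N by have [] := Hpick ((s n).+1, n.+1).
have su n : `|u (s n) - l| < (n.+1%:R : R)^-1 by case: n => [|n]; [have [] := Hpick (0%N, 0%N)|have [] := Hpick ((s n).+1, n.+1)].
exists s; split.
  move=> i j; elim: j => // j IH; rewrite ltnS leq_eqVlt => /orP[/eqP -> //|ij].
  exact: ltn_trans (IH ij) (sS j).
apply/cvgrPdist_lt => e e0; have [N HN] := natSinv_lt e0.
by exists N => // n Nn /=; rewrite distrC; apply: (lt_trans (su n)); exact: HN.
Qed.

Lemma omega_limitE (f_ : nat -> R -> R) y l :
  omega_limit f_ y l <-> cluster_pt (trajectory f_ y) l.
Proof. exact: cluster_subseqP. Qed.

Lemma omega_class0_cluster (F : R -> R) y l : omega_class F y 0 0 l <-> cluster_pt (fun n => iter n F y) l.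
Proof.
split=> H e e0 N.
  by have [n [Nn _ un]] := H e e0 N; exists n.
by have [n Nn un] := H e e0 N; exists n; rewrite expn0 !modn1.
Qed.

(** An orbit that converges along the multiples of T clusters at T points at
    most. *)
Lemma infinite_omega_nap (F : R -> R) y : continuous F ->
  infinite_set [set l | omega_class F y 0 0 l] -> not_asymptotically_periodic F y.
Proof.
move=> Fc inf T i l T0 H; apply: inf.
apply: (@sub_finite_set _ _ [set iter j F l | j in `I_T]); last exact/finite_image/finite_II.
move=> w /= Hw; apply: contrapT => nw.
have [e e0 far] : exists2 e, 0 < e & forall j, (j < T)%N -> e <= `|w - iter j F l|.
  have : forall j, (j < T)%N -> w != iter j F l.
    by move=> j jT; apply/eqP => wj; apply: nw; exists j.
  elim: (T) => [|T' IH] ne; first by exists 1.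
  have [|e e0 He] := IH; first by move=> j jT; apply: ne; exact: ltnW.
  exists (Num.min e `|w - iter T' F l|).
    by rewrite lt_min e0 normr_gt0 subr_eq0 ne.
  move=> j; rewrite ltnS leq_eqVlt ge_min => /orP[/eqP ->|jT]; first by rewrite lexx orbT.
  by rewrite He.
have e2 : 0 < e / 2 by lra.
have [d d0 Hd] := iter_close l T Fc e2; have [N HN] := H d d0.
have [m [Nm _ xm]] := Hw (e / 2) e2 (i + T * N.+1)%N.
pose q := ((m - i) %/ T)%N; pose j := ((m - i) %% T)%N.
have jT : (j < T)%N by rewrite ltn_mod.
have mE : m = (j + (i + T * q))%N.
  have im : (i <= m)%N by rewrite (leq_trans _ Nm) // leq_addr.
  by rewrite addnCA (addnC j) mulnC -divn_eq subnKC.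
have Nq : (N <= q)%N.
  rewrite /q leq_divRL //; rewrite -(leq_add2l i) subnKC; last by rewrite (leq_trans _ Nm) // leq_addr.
  by apply: leq_trans Nm; rewrite leq_add2l mulnC leq_mul2l leqnSn orbT.
have := Hd _ j (ltnW jT) (HN q Nq); rewrite -iterD -mE.
by have := far j jT; move: xm; rewrite ler_normr !ltr_norml; lra.
Qed.

Lemma trajectory_clamp (f_ : nat -> R -> R) y n :
  (forall n, (0 < n)%N -> set_fun (unit_itv R) (unit_itv R) (f_ n)) -> unit_itv R y ->
  trajectory (fun n => f_ n \o clamp) y n = trajectory f_ y n /\
  unit_itv R (trajectory f_ y n).
Proof.
move=> maps yI; elim: n => [//|n [IH In]] /=; rewrite IH clamp_id //; split=> //.
exact: maps.
Qed.

(** Finite pieces of the itinerary are realized backwards from the last interval; a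
    cluster point of their starting points realizes all of it. *)
Lemma follow_path (g : nat -> R -> R) T0 (I : nat -> R * R) :
  (forall n, continuous (g n.+1)) ->
  (forall j, (T0 <= j)%N -> covers (g j.+1) (I j) (I j.+1)) ->
  exists y, forall n, inI (I (T0 + n)%N) (trajectory (fun m => g (T0 + m)%N) y n).
Proof.
move=> gc cov; pose tr y n := trajectory (fun m => g (T0 + m)%N) y n.
have trc n : continuous (tr ^~ n).
  elim: n => [|n IH] y; first exact: cvg_id.
  apply: (@continuous_comp _ _ _ (tr ^~ n) (g (T0 + n.+1)%N)); first exact: IH.
  by rewrite addnS; exact: gc.
have finite n : forall p, inI (I (T0 + n)%N) p -> exists y, tr y n = p /\
    forall i, (i <= n)%N -> inI (I (T0 + i)%N) (tr y i).
  elim: n => [|n IH] p Ip.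
    by exists p; split=> // i; rewrite leqn0 => /eqP ->.
  rewrite addnS in Ip; have [q Iq gq] := cov _ (leq_addr n T0) p Ip.
  have [y [yn yi]] := IH q Iq; exists y.
  have yS : tr y n.+1 = p by rewrite /tr /= addnS -/(tr y n) yn.
  split=> // i; rewrite leq_eqVlt => /orP[/eqP ->|]; last by rewrite ltnS; exact: yi.
  by rewrite yS addnS.
have [s Hs] := choice (fun n => finite n _ (inI_l (I (T0 + n)%N))).
have s0 n : Num.min (I T0).1 (I T0).2 <= s n <= Num.max (I T0).1 (I T0).2.
  have [_ /(_ 0%N (leq0n n))] := Hs n; rewrite addn0 /inI /between /tr /=.
  by rewrite ge_min le_max => /orP[] /andP[-> ->]; rewrite ?orbT.
have [y _ Hy] := bounded_cluster s0; exists y => i; rewrite -/(tr y i).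
set A := I (T0 + i)%N; apply/negPn/negP => out.
have ne1 : tr y i != A.1 by apply: contraNneq out => ->; exact: inI_l.
have ne2 : tr y i != A.2 by apply: contraNneq out => ->; exact: inI_r.
have e0 : 0 < Num.min `|tr y i - A.1| `|tr y i - A.2|.
  by rewrite lt_min !normr_gt0 !subr_eq0 ne1.
have [d d0 Hd] := @cont_eps _ (tr ^~ i) y _ (trc i) e0.
have [n ni sn] := Hy d d0 i; have [_ /(_ i ni)] := Hs n; rewrite -/A.
have := Hd _ sn; rewrite lt_min => /andP[].
move: out ne1 ne2; rewrite /inI /between !neq_lt => out ne1 ne2.
have [lt1|ge1] := ltP (tr y i) A.1; have [lt2|ge2] := ltP (tr y i) A.2.
- by rewrite (@ltr0_norm _ (tr y i - A.1)) 1?(@ltr0_norm _ (tr y i - A.2)) ?ltr_norml; lra.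
- lra.
- lra.
- by rewrite (@ger0_norm _ (tr y i - A.1)) 1?(@ger0_norm _ (tr y i - A.2)) ?ltr_norml; lra.
Qed.

Lemma pull_to_start (f_ : nat -> R -> R) T0 p :
  (forall n, (0 < n)%N -> set_surj (unit_itv R) (unit_itv R) (f_ n)) -> unit_itv R p ->
  exists2 y, unit_itv R y & trajectory f_ y T0 = p.
Proof.
move=> surj; elim: T0 p => [|T0 IH] p pI; first by exists p.
have [q qI qp] := surj T0.+1 isT p pI; have [y yI yq] := IH q qI.
by exists y => //=; rewrite yq.
Qed.

Lemma trajectory_shift (f_ : nat -> R -> R) T0 y n :
  trajectory f_ y (T0 + n) = trajectory (fun m => f_ (T0 + m)%N) (trajectory f_ y T0) n.
Proof. by elim: n => [|n IH]; rewrite ?addn0 // addnS /= IH addnS. Qed.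

Lemma omega_realized (F : R -> R) z (f_ : nat -> R -> R) : tame F z ->
  (forall n, (0 < n)%N -> set_fun (unit_itv R) (unit_itv R) (f_ n)) ->
  (forall n, (0 < n)%N -> set_surj (unit_itv R) (unit_itv R) (f_ n)) ->
  perturbation F (fun n => f_ n \o clamp) ->
  exists2 y, unit_itv R y & forall l, cluster_pt (trajectory f_ y) l <-> omega_class F z 0 0 l.
Proof.
move=> H maps surj pert; have [T0 [I [I01 Icov Inear Ivisit]]] := infinite_path H pert.
have [p Hp] := follow_path pert.1 Icov.
have pI : unit_itv R p.
  by rewrite /unit_itv /= in_itv /=; apply: I01; have := Hp 0%N; rewrite addn0.
have [y yI yp] := pull_to_start T0 surj pI.
have inT j : (T0 <= j)%N -> inI (I j) (trajectory f_ y j).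
  move=> Tj; have := Hp (j - T0)%N; rewrite subnKC //.
  have [<- _] := trajectory_clamp j maps yI.
  have [yT _] := trajectory_clamp T0 maps yI.
  by rewrite -[in X in _ -> X](subnKC Tj) trajectory_shift yT yp.
exists y => // l; split=> [cl|Hl].
  apply: om_closed => e e0; have e2 : 0 < e / 2 by lra.
  have [N HN] := Inear _ e2; have [n Nn yn] := cl _ e2 (N + T0)%N.
  have [w Hw yw] := HN n ltac:(natlia) _ (inT n ltac:(natlia)).
  by exists w => //; move: yn yw; rewrite !ltr_norml; lra.
move=> e e0 N; have [j Nj jl] := Ivisit l e (N + T0)%N Hl e0.
by exists j; [natlia|apply/jl/inT; natlia].
Qed.

Lemma uniform_clamp (f_ : nat -> R -> R) (f : R -> R) :
  {uniform unit_itv R, f_ @ \oo --> f} -> forall e, 0 < e ->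
  exists N, forall n, (N <= n)%N -> forall y, `|(f_ n \o clamp) y - (f \o clamp) y| < e.
Proof.
move=> fu e e0.
have nb : nbhs (f : {uniform` unit_itv R -> R}) [set h | forall y, unit_itv R y -> `|h y - f y| < e].
  apply/uniform_nbhs; exists [set xy | ball xy.1 e xy.2]; split.
    exact: (entourage_ball R (PosNum e0)).
  by move=> h /= Hh y yI; rewrite distrC; exact: Hh.
have [N _ HN] := fu _ nb.
by exists N => n Nn y; apply: HN => //; exact: clamp_itv.
Qed.

End Realization.

Theorem theoremA (R : realType) (f_ : nat -> R -> R) (f : R -> R)
  (f_maps : forall n, (0 < n)%N -> set_fun (unit_itv R) (unit_itv R) (f_ n))
  (f_surj : forall n, (0 < n)%N -> set_surj (unit_itv R) (unit_itv R) (f_ n))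
  (f_cont : forall n, (0 < n)%N -> {within unit_itv R, continuous (f_ n)})
  (lim_maps : set_fun (unit_itv R) (unit_itv R) f)
  (f_unif : {uniform unit_itv R, f_ @ \oo --> f})
  (entropy0 : topological_entropy f = 0%E) :
  forall z, unit_itv R z -> infinite_set (omega_limit (fun=> f) z) ->
  exists2 y, unit_itv R y & omega_limit f_ y = omega_limit (fun=> f) z.
Proof.
move=> z zI inf; pose F := f \o clamp.
have unif := uniform_clamp f_unif.
have gc n : continuous (f_ n.+1 \o clamp) by apply: comp_clamp_continuous; exact: f_cont.
have Fc : continuous F.
  move=> x; apply/cvgrPdist_lt => e e0; have e3 : 0 < e / 3 by lra.
  have [N HN] := unif _ e3.
  have [d d0 Hd] := @cont_eps _ _ x _ (gc N) e3.
  exists d => //= y; rewrite /ball /= distrC => /Hd h.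
  have h1 := HN N.+1 (leqnSn N) x; have h2 := HN N.+1 (leqnSn N) y.
  by move: h h1 h2; rewrite -/F !ltr_norml; lra.
have itF n : iter n F z = iter n f z by exact: iter_clamp.
have trf n : trajectory (fun=> f) z n = iter n f z by elim: n => //= n ->.
have omE l : omega_limit (fun=> f) z l <-> omega_class F z 0 0 l.
  rewrite omega_limitE omega_class0_cluster; split=> cl e e0 N; have [n Nn un] := cl e e0 N;
    by exists n => //; move: un; rewrite itF trf.
have tF : tame F z.
  split=> //.
  - exact: entropy0_no_fold.
  - apply: infinite_omega_nap => // fin; apply: inf; apply: sub_finite_set fin => l.
    by move/omE.
  - elim=> [|n _] /=; first by move: zI; rewrite /unit_itv /= in_itv.
    by have := lim_maps _ (clamp_itv (iter n F z)); rewrite /unit_itv /= in_itv.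
have [y yI yom] := omega_realized tF f_maps f_surj (conj gc unif).
exists y => //; apply/seteqP; split=> l.
  by move=> /omega_limitE/yom/omE.
by move=> /omE/yom/omega_limitE.
Qed.
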